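(* Let $d\ge1$ and assume $\beta_*:=\inf_{i\in I}\widetilde w_i/w_i>0$. For each $t\in[0,T]$, $$\mathbb E_{X\sim\rho_t^d}\Big\|\sum_{i\in I}p_{i,t}^d(X)\,(\Gamma^d)^{1/2}\big(S_{i,t}^d-\widetilde S_{i,t}^d\big)(X)\Big\|^2\le\mathsf B_{\mathrm{comp}}^d(t),$$ with $$\mathsf B_{\mathrm{comp}}^d(t):=2\sum_{i\in I}w_i\sum_{j=1}^d\gamma_j\,\frac{(\Delta m_{ij})^2+\frac{(\Delta\sigma_{ij})^2}{\sigma_{ij}+\kappa_t\lambda_j}}{\big(\sigma_{ij}+\Delta\sigma_{ij}+\kappa_t\lambda_j\big)^2}.$$ Moreover, $$\mathbb E_{X\sim\rho_t^d}\Big\|\sum_{i\in I}\big(p_{i,t}^d-\widetilde p_{i,t}^d\big)(X)\,(\Gamma^d)^{1/2}\widetilde S_{i,t}^d(X)\Big\|^2\le\mathsf B_{\mathrm{resp}}^d(t),$$ with $$\mathsf B_{\mathrm{resp}}^d(t):=\beta_*^{-2}\,\mathcal D(t,d)^{1/4}\,\mathcal R(t,d)^{1/4}\,\mathcal S_{\mathrm{pair}}(t,d)^{1/2}.$$ Consequently, $$\mathcal E_{\mathrm{score},T}^d:=\frac12\int_0^T\mathbb E_{X\sim\rho_t^d}\big\|(\Gamma^d)^{1/2}\epsilon_t^d(X)\big\|^2\,dt\le\int_0^T\Big(\mathsf B_{\mathrm{comp}}^d(t)+\mathsf B_{\mathrm{resp}}^d(t)\Big)\,dt,\qquad \epsi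lon_t^d:=\nabla\log\rho_t^d-\nabla\log\widetilde\rho_t^{\,d}.$$
   Context: Setting. $T>0$ is fixed and $\kappa_t:=(T-t)/T$ for $t\in[0,T]$. $I$ is a finite or countably infinite index set; $w_i>0$, $\sum_{i\in I}w_i=1$. For $i\in I$, $j\ge1$: $m_{ij}\in\mathbb R$, $\sigma_{ij}>0$ with $\sum_jm_{ij}^2<\infty$, $\sum_j\sigma_{ij}<\infty$ for every $i$. $\lambda_j>0$ with $\sum_j\lambda_j<\infty$; $\gamma_j>0$. Perturbed parameters: $\widetilde m_{ij}=m_{ij}+\Delta m_{ij}$; perturbed variances $\sigma_{ij}+\Delta\sigma_{ij}>0$; $\widetilde w_i=w_i+\Delta w_i>0$ with $\sum_{i\in I}\widetilde w_i=1$. None of these sequences depends on $d$. For $d\ge1$: $\Gamma^d=\mathrm{Diag}(\gamma_1,\dots,\gamma_d)$, $m_i^d=(m_{i1},\dots,m_{id})$, $\widetilde m_i^d=(\widetilde m_{i1},\dots,\widetilde m_{id})$, and $$v_{ij}(t):=\sigma_{ij}+\kappa_t\lambda_j,\qquad \widetilde v_{ij}(t):=\sigma_{ij}+\Delta\sigma_{ij}+\kappa_t\lambda_j,$$ $$\Sigma_{i,t}^d:=\mathrm{Diag}(v_{ij}(t))_{j=1}^d,\qquad \widetilde\Sigma_{i,t}^d:=\mathrm{Diag}(\widetilde v_{ij}(t))_{j=1}^d.$$ $\varphi_{i,t}^d$ and $\widetilde\varphi_{i,t}^d$ are the densities of $\mathcal N(m_i^d,\Sigma_{i,t}^d)$ and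 $\mathcal N(\widetilde m_i^d,\widetilde\Sigma_{i,t}^d)$, and $$\rho_t^d=\sum_{i\in I}w_i\varphi_{i,t}^d,\qquad \widetilde\rho_t^{\,d}=\sum_{i\in I}\widetilde w_i\widetilde\varphi_{i,t}^d,\qquad p_{i,t}^d=\frac{w_i\varphi_{i,t}^d}{\rho_t^d},\qquad \widetilde p_{i,t}^d=\frac{\widetilde w_i\widetilde\varphi_{i,t}^d}{\widetilde\rho_t^{\,d}},$$ $$S_{i,t}^d(x):=-(\Sigma_{i,t}^d)^{-1}(x-m_i^d),\qquad \widetilde S_{i,t}^d(x):=-(\widetilde\Sigma_{i,t}^d)^{-1}(x-\widetilde m_i^d).$$ Quantities in $\mathsf B_{\mathrm{resp}}^d$. With $\beta_i:=\widetilde w_i/w_i$ and $r_i:=\widetilde\varphi_{i,t}^d/\varphi_{i,t}^d$, $$\mathcal D(t,d):=\sum_{i\in I}w_i\,\mathbb E_{X\sim\varphi_{i,t}^d}\big[(\beta_ir_i(X)-1)^8\big],\qquad \mathcal R(t,d):=\sum_{i\in I}w_i\,\mathbb E_{X\sim\varphi_{i,t}^d}\big[r_i(X)^{-8}\big],$$ $$\mathcal S_{\mathrm{pair}}(t,d):=\sum_{i,\ell\in I}w_iw_\ell\Big(\sum_{j=1}^d\gamma_jH_{i\ell,j}(t)\Big)^2,$$ where $$a_{i\ell,j}(t):=\frac1{\widetilde v_{ij}(t)}-\frac1{\widetilde v_{\ell j}(t)},\qquad \mu_{i\ell,j}(t):=\frac{\Delta m_{ij}}{\widetilde v_{ij}(t)}-\frac{m_{\ell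 j}-m_{ij}+\Delta m_{\ell j}}{\widetilde v_{\ell j}(t)},$$ $$H_{i\ell,j}(t):=\Big(3a_{i\ell,j}(t)^4v_{ij}(t)^2+6a_{i\ell,j}(t)^2v_{ij}(t)\mu_{i\ell,j}(t)^2+\mu_{i\ell,j}(t)^4\Big)^{1/2}.$$ All these quantities take values in $[0,+\infty]$. For countably infinite $I$ the estimates are asserted whenever the quantities appearing in the upper bounds are finite. *)

(* Defs.v *)
From HB Require Import structures.
From mathcomp Require Import all_boot all_order all_algebra.
From mathcomp Require Import all_classical all_reals all_analysis.

Set Implicit Arguments.
Unset Strict Implicit.
Unset Printing Implicit Defensive.

Import Order.TTheory GRing.Theory Num.Theory.
Import numFieldNormedType.Exports.

Local Open Scope classical_set_scope.
Local Open Scope ring_scope.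

Section rV_measurable.
Variables (R : realType) (n : nat).

Definition rV_coord (i : 'I_n) (x : 'rV[R]_n) : R := x ord0 i.

(* The Borel sigma-algebra of 'rV_n, generated by the coordinate maps. *)
Let rV_set0 : g_sigma_preimage rV_coord set0.
Proof. exact: sigma_algebra0. Qed.

Let rV_setC A : g_sigma_preimage rV_coord A -> g_sigma_preimage rV_coord (~` A).
Proof. exact: sigma_algebraC. Qed.

Let rV_bigcup (F : (set 'rV[R]_n)^nat) :
  (forall i, g_sigma_preimage rV_coord (F i)) ->
  g_sigma_preimage rV_coord (\bigcup_i F i).
Proof. exact: sigma_algebra_bigcup. Qed.

HB.instance Definition _ := @isMeasurable.Build default_measure_display
  'rV[R]_n (g_sigma_preimage rV_coord) rV_set0 rV_setC rV_bigcup.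

Lemma measurable_rV_coord (i : 'I_n) :
  measurable_fun [set: 'rV[R]_n] (rV_coord i).
Proof.
move=> _ Y mY; rewrite setTI; apply: sub_sigma_algebra => /=.
rewrite -bigcup_seq/=; exists i => /=; first by rewrite mem_index_enum.
by exists Y => //; rewrite setTI.
Qed.

Lemma measurable_fun_rVP d (T : measurableType d) (f : T -> 'rV[R]_n) :
  (forall i, measurable_fun [set: T] (fun x => f x ord0 i)) ->
  measurable_fun [set: T] f.
Proof.
move=> mf _ A mA; rewrite setTI.
suff : g_sigma_preimage (fun i => rV_coord i \o f) `<=` measurable.
  by apply; rewrite g_sigma_preimage_comp; exists A => //; rewrite setTI.
apply: smallest_sub; first exact: sigma_algebra_measurable.
rewrite -bigcup_seq/=; apply: bigcup_sub => i _ _ [B mB <-].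
exact: (mf i).
Qed.

End rV_measurable.

Section rV_cons.
Variable R : realType.

Definition rV_cons n (p : R * 'rV[R]_n) : 'rV[R]_n.+1 :=
  row_mx (const_mx p.1 : 'rV_1) p.2.

Lemma rV_cons0 n p : @rV_cons n p ord0 ord0 = p.1.
Proof.
have -> : ord0 = lshift n (ord0 : 'I_1) by exact: val_inj.
by apply: etrans (row_mxEl _ _ _ _) _; rewrite mxE.
Qed.

Lemma rV_consS n p (i : 'I_n) : @rV_cons n p ord0 (lift ord0 i) = p.2 ord0 i.
Proof.
have -> : lift ord0 i = rshift 1 i by exact: val_inj.
exact: row_mxEr.
Qed.

Lemma measurable_rV_cons n : measurable_fun [set: R * 'rV[R]_n] (@rV_cons n).
Proof.
apply: measurable_fun_rVP => i; have [j ->|->] := unliftP ord0 i.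
- under eq_fun do rewrite rV_consS.
  exact: (measurableT_comp (measurable_rV_coord j) measurable_snd).
- under eq_fun do rewrite rV_cons0.
  exact: measurable_fst.
Qed.

End rV_cons.

Section rV_cons_measure_theory.
Local Open Scope ereal_scope.
Variables (R : realType) (n : nat).
Variable m : {sigma_finite_measure set 'rV[R]_n -> \bar R}.

Definition rV_cons_measure : set 'rV[R]_n.+1 -> \bar R :=
  pushforward (@lebesgue_measure R \x m) (@rV_cons R n).

Local Notation mu := rV_cons_measure.

Let mu0 : mu set0 = 0.
Proof. by rewrite /rV_cons_measure /pushforward preimage_set0 measure0. Qed.

Let mu_ge0 A : 0 <= mu A.
Proof. exact: (@measure_ge0 _ _ _ (lebesgue_measure \x m)). Qed.

Let preimage_rV_cons A : measurable A -> measurable (@rV_cons R n @^-1` A).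
Proof.
by move=> mA; rewrite -[X in measurable X]setTI; exact: measurable_rV_cons.
Qed.

Let mu_sigma_additive : semi_sigma_additive mu.
Proof.
move=> F mF tF mUF; rewrite /rV_cons_measure /pushforward preimage_bigcup.
apply: measure_semi_sigma_additive => [k||].
- exact: preimage_rV_cons.
- apply/trivIsetP => /= i j _ _ ij; rewrite -preimage_setI.
  by move/trivIsetP : tF => /(_ _ _ _ _ ij) ->//; rewrite preimage_set0.
- by rewrite -preimage_bigcup; exact: preimage_rV_cons.
Qed.

HB.instance Definition _ := isMeasure.Build _ _ _ mu
  mu0 mu_ge0 mu_sigma_additive.

Let mu_sigma_finite : sigma_finite setT mu.
Proof.
have [F TF Foo] : sigma_finite setT (@lebesgue_measure R \x m).
  have /sigma_finiteP[F [TF ndF Foo]] := sigma_finiteT (@lebesgue_measure R).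
  have /sigma_finiteP[G [TG ndG Goo]] := sigma_finiteT m.
  exists (fun k => F k `*` G k).
    rewrite -setXTT TF TG predeqE => -[x y]; split; last first.
      by move=> [k _ []/= ? ?]; split; exists k.
    move=> [/= [k _ Fkx] [l _ Gly]]; exists (maxn k l) => //; split.
    - by move: x Fkx; exact/subsetPset/ndF/leq_maxl.
    - by move: y Gly; exact/subsetPset/ndG/leq_maxr.
  move=> k; have [? ?] := Foo k; have [? ?] := Goo k.
  split; first exact: measurableX.
  by rewrite product_measure1E// lte_mul_pinfty// ge0_fin_numE.
pose g (x : 'rV[R]_n.+1) : measurableTypeR R * 'rV[R]_n :=
  (x ord0 ord0, \row_i x ord0 (lift ord0 i)).
have gK : cancel g (@rV_cons R n).
  move=> x; apply/rowP => i; have [j ->|->] := unliftP ord0 i.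
    by rewrite rV_consS mxE.
  by rewrite rV_cons0.
have Kg : cancel (@rV_cons R n) g.
  move=> [a v]; rewrite /g rV_cons0; congr pair.
  by apply/rowP => i; rewrite mxE rV_consS.
have mg : measurable_fun setT g.
  apply/measurable_fun_pairP; split; first exact: (@measurable_rV_coord R n.+1).
  apply: measurable_fun_rVP => i; rewrite [X in measurable_fun _ X](_ : _ =
    @rV_coord R n.+1 (lift ord0 i)); first exact: measurable_rV_coord.
  by apply/funext => x /=; rewrite mxE.
exists (fun k => g @^-1` F k).
  by rewrite -preimage_bigcup -TF preimage_setT.
move=> k; have [mF Fk] := Foo k; split.
  by rewrite -[X in measurable X]setTI; exact: mg.
rewrite /rV_cons_measure /pushforward -comp_preimage (_ : g \o _ = id)//.
by apply/funext => p; rewrite /= Kg.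
Qed.

HB.instance Definition _ :=
  Measure_isSigmaFinite.Build _ _ _ mu mu_sigma_finite.

End rV_cons_measure_theory.

(* Lebesgue measure on R^n, as the iterated product along R^n = R * R^(n-1). *)
Fixpoint lebesgue_rV (R : realType) n :
    {sigma_finite_measure set 'rV[R]_n -> \bar R} :=
  match n with
  | 0 => @dirac _ 'rV[R]_0 0 R
  | n.+1 => rV_cons_measure (lebesgue_rV R n)
  end.

Lemma measurable_rV_box (R : realType) n (A : 'I_n -> set R) :
  (forall i, measurable (A i)) ->
  measurable [set x : 'rV[R]_n | forall i, A i (x ord0 i)].
Proof.
move=> mA; rewrite [X in measurable X](_ : _ =
    \big[setI/setT]_(i < n) (@rV_coord R n i @^-1` A i)).
  apply: bigsetI_measurable => i _; rewrite -[X in measurable X]setTI.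
  exact: measurable_rV_coord.
rewrite -bigcap_seq/=; apply/seteqP; split=> x /=.
  by move=> Ax i _; exact: Ax.
by move=> Ax i; apply: Ax; rewrite /= mem_index_enum.
Qed.

Lemma lebesgue_rV_box (R : realType) n (A : 'I_n -> set R) :
  (forall i, measurable (A i)) ->
  lebesgue_rV R n [set x | forall i, A i (x ord0 i)] =
  (\prod_(i < n) lebesgue_measure (A i))%E.
Proof.
elim: n A => [|n IHn] A mA.
  by rewrite big_ord0 /= diracE mem_set//; case.
have mA' i : measurable (A (lift ord0 i)) by exact: mA.
rewrite big_ord_recl -(IHn _ mA').
have mB : measurable [set x : 'rV[R]_n | forall i, A (lift ord0 i) (x ord0 i)].
  exact: (measurable_rV_box mA').
rewrite -(product_measure1E lebesgue_measure (lebesgue_rV R n) (mA ord0) mB).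
rewrite /= /rV_cons_measure /pushforward; congr (_ \x _)%E.
apply/seteqP; split=> -[a x] /=.
  move=> Ax; split; first by have := Ax ord0; rewrite rV_cons0.
  by move=> i; have := Ax (lift ord0 i); rewrite rV_consS.
move=> [Aa Ax] i; have [j ->|->] := unliftP ord0 i.
  by rewrite rV_consS; exact: Ax.
by rewrite rV_cons0.
Qed.

(* Sum of a family of reals over I: the absolutely convergent sum when
   [summable [set: I] (EFin \o f)] holds, an arbitrary value otherwise. *)
Definition usum (R : realType) (I : choiceType) (f : I -> R) : R :=
  fine (\esum_(i in [set: I]) (EFin \o f)^\+ i)%E -
  fine (\esum_(i in [set: I]) (EFin \o f)^\- i)%E.

Section euclidean.
Variables (R : realType) (d : nat).

(* The norm of the normed module 'rV_d is the sup norm, hence this one. *)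
Definition sqnorm (x : 'rV[R]_d) : R := \sum_(j < d) x ord0 j ^+ 2.

(* | \sum_i F i |^2, set to +oo where the series does not converge absolutely,
   so that an upper bound on its expectation entails convergence almost
   everywhere. *)
Definition sqnorm_usum (I : choiceType) (F : I -> 'rV[R]_d) : \bar R :=
  if `[< forall j, summable [set: I] (fun i => (F i ord0 j)%:E) >] then
    (sqnorm (\row_j usum (fun i => F i ord0 j)))%:E
  else +oo%E.

Definition gradient (f : 'rV[R]_d -> R) (x : 'rV[R]_d) : 'rV[R]_d :=
  \row_j 'D_(delta_mx ord0 j) f x.

(* E_(X ~ p) [f X] for f >= 0, where p is a density. *)
Definition expect (p : 'rV[R]_d -> R) (f : 'rV[R]_d -> \bar R) : \bar R :=
  (\int[lebesgue_rV R d]_x ((p x)%:E * f x))%E.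

Definition gauss_pdf (mu : 'rV[R]_d) (S : 'M[R]_d) (x : 'rV[R]_d) : R :=
  expR (- ((x - mu) *m invmx S *m (x - mu)^T) ord0 ord0 / 2) /
  Num.sqrt ((2 * pi) ^+ d * \det S).

End euclidean.

(* Indices j >= 1 are shifted to j : nat. *)
Record mixture_data (R : realType) (I : Type) := MixtureData {
  horizon : R;
  weight : I -> R;
  dweight : I -> R;
  mean : I -> nat -> R;
  dmean : I -> nat -> R;
  sigma : I -> nat -> R;
  dsigma : I -> nat -> R;
  lambda : nat -> R;
  gamma : nat -> R }.

(* Vectors are rows, so matrices act on the right; [v i j] is the j-th variance
   of the i-th component. *)
Section mixture.
Variables (R : realType) (I : choiceType) (d : nat).
Variables (w : I -> R) (m v : I -> nat -> R).
Implicit Types (i : I) (x : 'rV[R]_d).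

Definition mix_mean i : 'rV[R]_d := \row_j m i j.
Definition mix_cov i : 'M[R]_d := diag_mx (\row_j v i j).
Definition mix_comp i x : R := gauss_pdf (mix_mean i) (mix_cov i) x.
Definition mix_pdf x : R := usum (fun i => w i * mix_comp i x).
Definition mix_post i x : R := w i * mix_comp i x / mix_pdf x.
Definition mix_score i x : 'rV[R]_d := - ((x - mix_mean i) *m invmx (mix_cov i)).

End mixture.

Section bounds.
Variables (R : realType) (I : choiceType) (P : mixture_data R I).
Implicit Types (t : R) (d : nat) (i l : I) (j : nat).

Local Notation T := (horizon P).
Local Notation w := (weight P).
Local Notation m := (mean P).
Local Notation dm := (dmean P).
Local Notation dsig := (dsigma P).

Definition kappa t : R := (T - t) / T.

(* pweight, pmean, pvar, pphi, prho, ppost and pscore are the perturbed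
   counterparts of weight, mean, var, phi, rho, post and score. *)
Definition pweight i : R := w i + dweight P i.
Definition pmean i j : R := m i j + dm i j.

Definition var t i j : R := sigma P i j + kappa t * lambda P j.
Definition pvar t i j : R := sigma P i j + dsig i j + kappa t * lambda P j.

Definition phi t d i : 'rV[R]_d -> R := mix_comp m (var t) i.
Definition pphi t d i : 'rV[R]_d -> R := mix_comp pmean (pvar t) i.
Definition rho t d : 'rV[R]_d -> R := mix_pdf w m (var t).
Definition prho t d : 'rV[R]_d -> R := mix_pdf pweight pmean (pvar t).
Definition post t d i : 'rV[R]_d -> R := mix_post w m (var t) i.
Definition ppost t d i : 'rV[R]_d -> R := mix_post pweight pmean (pvar t) i.
Definition score t d i : 'rV[R]_d -> 'rV[R]_d := mix_score m (var t) i.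
Definition pscore t d i : 'rV[R]_d -> 'rV[R]_d := mix_score pmean (pvar t) i.

Definition sqrt_Gamma d : 'M[R]_d := diag_mx (\row_j Num.sqrt (gamma P j)).

Definition beta i : R := pweight i / w i.
Definition beta_star : R := inf (range beta).
Definition ratio t d i (x : 'rV[R]_d) : R := pphi t i x / phi t i x.

Definition B_comp t d : \bar R :=
  (2%:E * \esum_(i in [set: I]) (w i * \sum_(j < d) gamma P j *
    ((dm i j ^+ 2 + dsig i j ^+ 2 / var t i j) / pvar t i j ^+ 2))%:E)%E.

Definition D_resp t d : \bar R :=
  (\esum_(i in [set: I]) ((w i)%:E *
    expect (@phi t d i) (fun x => ((beta i * ratio t i x - 1) ^+ 8)%:E)))%E.

Definition R_resp t d : \bar R :=
  (\esum_(i in [set: I]) ((w i)%:E *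
    expect (@phi t d i) (fun x => (ratio t i x ^- 8)%:E)))%E.

Definition a_pair t i l j : R := (pvar t i j)^-1 - (pvar t l j)^-1.

Definition mu_pair t i l j : R :=
  dm i j / pvar t i j - (m l j - m i j + dm l j) / pvar t l j.

Definition H_pair t i l j : R :=
  Num.sqrt (3 * a_pair t i l j ^+ 4 * var t i j ^+ 2 +
            6 * a_pair t i l j ^+ 2 * var t i j * mu_pair t i l j ^+ 2 +
            mu_pair t i l j ^+ 4).

Definition S_pair t d : \bar R :=
  (\esum_(i in [set: I]) \esum_(l in [set: I])
    (w i * w l * (\sum_(j < d) gamma P j * H_pair t i l j) ^+ 2)%:E)%E.

Definition B_resp t d : \bar R :=
  ((beta_star ^- 2)%:E *
    D_resp t d `^ (4^-1)%R * R_resp t d `^ (4^-1)%R *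
    S_pair t d `^ (2^-1)%R)%E.

Definition comp_error t d : \bar R :=
  expect (@rho t d) (fun x => sqnorm_usum (fun i =>
    post t i x *: ((score t i x - pscore t i x) *m sqrt_Gamma d))).

Definition resp_error t d : \bar R :=
  expect (@rho t d) (fun x => sqnorm_usum (fun i =>
    (post t i x - ppost t i x) *: (pscore t i x *m sqrt_Gamma d))).

Definition score_error t d (x : 'rV[R]_d) : 'rV[R]_d :=
  gradient (fun y => ln (rho t y)) x - gradient (fun y => ln (prho t y)) x.

Definition E_score d : \bar R :=
  ((2^-1)%:E * \int[lebesgue_measure]_(t in `[0%R, T])
    expect (@rho t d) (fun x => (sqnorm (score_error t x *m sqrt_Gamma d))%:E))%E.

End bounds.

(* Main.v *)
Require Import Defs.
From mathcomp Require Import all_boot all_order all_algebra.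
From mathcomp Require Import all_classical all_reals all_analysis.
From mathcomp Require Import measurable_realfun.
From mathcomp Require Import ring lra.

(** Why the bounds hold.  Fix a time and a point [x], and write
    [q_i = w_i phi_i(x)] for the weighted densities, [rho] for their sum,
    [p_i = q_i / rho] for the posterior probabilities, [u_i = beta_i r_i(x)] for
    the ratio of the perturbed weighted density to [q_i], and [S_i], [S'_i] for
    the scores of the components and of the perturbed components.

    Component error.  By Jensen's inequality under the probabilities [p_i],
    [rho |\sum p_i (S_i - S'_i)|^2 <= \sum q_i |S_i - S'_i|^2]
    ([jensen_sqnorm_usum]).  The differences [S_i - S'_i] are affine in [x], and
    [q_i dx] is [w_i] times a Gaussian law, so the right-hand side integrates to
    second moments of one-dimensional Gaussian variables.

    Responsibility error.  The perturbed posterior probability of [i] is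
    [p_i u_i / ubar], where [ubar] is the posterior mean of [u].  The
    differences [p_i (ubar - u_i) / ubar] of the two posteriors add up to zero,
    so the vectors [S'_i] may be recentred at any one of them, [S'_l], and
    Cauchy-Schwarz gives
    [ubar^2 |error|^2 <= (\sum p_i (u_i - 1)^2) (\sum p_i |S'_i - S'_l|^2)].
    The index [l] is chosen so that [\sum p_i |S'_i - S'_l|^4], which controls
    the last factor, does not exceed its average under the weights [w_l]: this
    is how the weights [w_i w_l] of the pair sum arise instead of products of
    two posterior probabilities.  Power means turn
    the bound into a pointwise one by the three factors
    [(\sum q_i (u_i - 1)^8)^(1/4)], [(\sum q_i r_i^-8)^(1/4)] and
    [(\sum q_i w_l |S'_i - S'_l|^4)^(1/2)], the lower bound [beta_star] on
    [beta_i] entering with the exponent -2 ([posterior_error_bound]).  Hölder's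
    inequality with exponents 4, 4 and 2 then distributes the integral over
    them, and fourth moments of Gaussian variables give the pair sum.

    Score error.  Before the horizon the variances are bounded below uniformly
    over the components, which allows the mixtures to be differentiated term by
    term: their scores are posterior averages ([gradient_ln_mix_pdf]).  Hence
    the score error is the sum of the two errors above, and the factor 1/2
    absorbs the 2 of [(a + b)^2 <= 2 a^2 + 2 b^2].  The integral of a function
    that may fail to be measurable is monotone but only superadditive
    ([ge0_le_integral_off]).  This is why the error integrands are first
    replaced by measurable majorants, which are added before the integration,
    and why the integral over time is treated by monotonicity alone. *)

Set Implicit Arguments.
Unset Strict Implicit.
Unset Printing Implicit Defensive.

Import Order.TTheory GRing.Theory Num.Theory.
Import numFieldNormedType.Exports.
Local Open Scope classical_set_scope.
Local Open Scope ring_scope.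

(** * Integrals of functions not known to be measurable *)

Section lower_integral.
Local Open Scope ereal_scope.
Context d (T : measurableType d) (R : realType).
Variable mu : {measure set T -> \bar R}.

Import HBNNSimple.

(** The integral of a nonnegative function is a supremum over the simple
    functions below it, whether or not the function is measurable.  A simple
    function below [f] becomes one below [g] once it is multiplied by [k] and
    set to zero on [N], which multiplies its integral by exactly [k].  The
    factor [k] is part of the statement because pulling it out of the integral
    of [f] would need [f] to be measurable. *)
Lemma ge0_le_integral_off (D N : set T) (f g : T -> \bar R) (k : R) :
  measurable N -> mu N = 0 -> (0 <= k)%R ->
  (forall x, D x -> 0 <= f x) -> (forall x, D x -> 0 <= g x) ->
  (forall x, D x -> ~ N x -> k%:E * f x <= g x) ->
  k%:E * \int[mu]_(x in D) f x <= \int[mu]_(x in D) g x.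
Proof.
move=> mN N0 k0 f0 g0 fg.
have [->|kn0] := eqVneq k 0%R; first by rewrite mul0e integral_ge0.
have {kn0}k_gt0 : (0 < k)%R by rewrite lt0r kn0.
rewrite -lee_pdivlMl// !ge0_integralE//; apply: ge_ereal_sup => _ [h hf <-].
rewrite lee_pdivlMl//.
pose h' := scale_nnsfun (proj_nnsfun h (measurableC mN)) k0.
have h'E x : h' x = (k * (if x \in ~` N then h x else 0))%R.
  transitivity (k * proj_nnsfun h (measurableC mN) x)%R => //.
  by rewrite -mrestrict patchE.
suff -> : k%:E * sintegral mu h = sintegral mu h'.
  apply: ereal_sup_ubound; exists h' => // x.
  change ((h' x)%:E <= (g \_ D) x); rewrite h'E patchE.
  have := hf x; rewrite patchE.
  have [xD|xD] := boolP (x \in D); last first.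
    rewrite lee_fin => hx; rewrite (_ : h x = 0%R) ?if_same ?mulr0//.
    by apply/le_anti/andP; split.
  have Dx := set_mem xD.
  have [xN|xN] := boolP (x \in ~` N); last by rewrite !mulr0 g0.
  move=> hfx; apply: le_trans (fg _ Dx _); last exact/set_mem.
  by rewrite EFinM lee_pmul2l.
rewrite -!integralT_nnsfun -ge0_integralZl_EFin//; last 2 first.
- by move=> x _; rewrite lee_fin.
- exact/measurable_EFinP.
apply: ge0_ae_eq_integral => //.
- by apply: measurable_funeM; exact/measurable_EFinP.
- exact/measurable_EFinP.
- by move=> x _; rewrite mule_ge0// lee_fin.
- by move=> x _; rewrite lee_fin.
exists N; split => // x /=; apply: contra_notP => Nx _.
by rewrite -EFinM; have := h'E x; rewrite mem_set// => <-.
Qed.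

Lemma ge0_le_integral_nonmeas (f g : T -> \bar R) :
  (forall x, 0 <= f x) -> (forall x, f x <= g x) ->
  \int[mu]_x f x <= \int[mu]_x g x.
Proof.
move=> f0 fg; rewrite -[leLHS]mul1e.
apply: (@ge0_le_integral_off setT set0) => //.
by move=> x _; apply: le_trans (fg x).
by move=> x _ _; rewrite mul1e.
Qed.

End lower_integral.

(** * Hölder's inequality with exponents 4, 4 and 2 *)

Section integral_hoelder.
Local Open Scope ereal_scope.
Context d (T : measurableType d) (R : realType).
Variable mu : {measure set T -> \bar R}.

Lemma young_sqrte (a b : \bar R) (c : R) : 0 <= a -> 0 <= b -> (0 < c)%R ->
  2%:E * (a `^ 2^-1 * b `^ 2^-1) <= c%:E * a + c^-1%:E * b.
Proof.
move=> a0 b0 c0.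
have ci0 : (0 < c^-1)%R by rewrite invr_gt0.
case: a a0 => [a a0|_|//]; last first.
  rewrite gt0_muley// addye ?leey// gt_eqF// (@lt_le_trans _ _ 0)//.
  by rewrite mule_ge0// lee_fin ltW.
case: b b0 => [b b0|_|//]; last first.
  by rewrite [X in _ + X]gt0_muley// addey ?leey.
rewrite !poweR_EFin -!EFinM -EFinD lee_fin !powR12_sqrt//.
set x := Num.sqrt a; set y := Num.sqrt b.
rewrite -(sqr_sqrtr a0) -(sqr_sqrtr b0) -/x -/y -subr_ge0.
have -> : (c * x ^+ 2 + c^-1 * y ^+ 2 - 2 * (x * y) =
  c^-1 * (c * x - y) ^+ 2)%R by field; rewrite gt_eqF.
by rewrite mulr_ge0 ?sqr_ge0// ltW.
Qed.

Lemma emeasurable_fun_poweR (f : T -> \bar R) r : measurable_fun setT f ->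
  measurable_fun setT (fun x => f x `^ r).
Proof. by move=> mf; exact: measurableT_comp (measurable_poweR _) mf. Qed.

(** Young's inequality is integrated with a free parameter [c] and then
    optimised.  A factor of integral zero vanishes almost everywhere, so that
    the bound survives the convention [0 * +oo = 0]. *)
Lemma integral_cauchy_schwarz (f g : T -> \bar R) :
  measurable_fun setT f -> measurable_fun setT g ->
  (forall x, 0 <= f x) -> (forall x, 0 <= g x) ->
  \int[mu]_x (f x `^ 2^-1 * g x `^ 2^-1) <=
  (\int[mu]_x f x) `^ 2^-1 * (\int[mu]_x g x) `^ 2^-1.
Proof.
move=> mf mg f0 g0.
have half0 : (2^-1 != 0 :> R)%R by rewrite invr_eq0.
have mfg : measurable_fun setT (fun x => f x `^ 2^-1 * g x `^ 2^-1).
  by apply: emeasurable_funM; exact: emeasurable_fun_poweR.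
have fg0 x : 0 <= f x `^ 2^-1 * g x `^ 2^-1 by rewrite mule_ge0 ?poweR_ge0.
have If0 : 0 <= \int[mu]_x f x by exact: integral_ge0.
have Ig0 : 0 <= \int[mu]_x g x by exact: integral_ge0.
have zero h : measurable_fun setT h -> (forall x, 0 <= h x) ->
    \int[mu]_x h x = 0 -> ae_eq mu setT h (cst 0).
  move=> mh h0 ih; apply/ae_eq_integral_abs => //.
  by under eq_integral do rewrite gee0_abs//.
have [f_0|fn0] := eqVneq (\int[mu]_x f x) 0.
  rewrite f_0 poweR0r// mul0e (ge0_ae_eq_integral (g := cst 0)) ?integral0//.
  apply: filterS (zero _ mf f0 f_0) => x + _; move=> /(_ I) ->.
  by rewrite poweR0r// mul0e.
have [g_0|gn0] := eqVneq (\int[mu]_x g x) 0.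
  rewrite g_0 [X in _ <= _ * X]poweR0r// mule0.
  rewrite (ge0_ae_eq_integral (g := cst 0)) ?integral0//.
  apply: filterS (zero _ mg g0 g_0) => x + _; move=> /(_ I) ->.
  by rewrite [X in _ * X]poweR0r// mule0.
have Ifg : 0 < \int[mu]_x f x by rewrite lt0e fn0.
have Igg : 0 < \int[mu]_x g x by rewrite lt0e gn0.
have [foo|ffin] := eqVneq (\int[mu]_x f x) +oo.
  by rewrite foo poweRyr// gt0_mulye ?leey// poweR_gt0.
have [goo|gfin] := eqVneq (\int[mu]_x g x) +oo.
  by rewrite goo [X in _ * X]poweRyr// gt0_muley ?leey// poweR_gt0.
have {}ffin : \int[mu]_x f x \is a fin_num by rewrite ge0_fin_numE// ltey.
have {}gfin : \int[mu]_x g x \is a fin_num by rewrite ge0_fin_numE// ltey.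
have young c : (0 < c)%R -> 2%:E * \int[mu]_x (f x `^ 2^-1 * g x `^ 2^-1) <=
    c%:E * \int[mu]_x f x + c^-1%:E * \int[mu]_x g x.
  move=> c0; have ci0 : (0 < c^-1)%R by rewrite invr_gt0.
  rewrite -!ge0_integralZl_EFin//; try exact: ltW.
  rewrite -ge0_integralD//; [|by move=> x _; rewrite mule_ge0// lee_fin ltW
    |exact: measurable_funeM|by move=> x _; rewrite mule_ge0// lee_fin ltW
    |exact: measurable_funeM].
  apply: ge0_le_integral_nonmeas => x; first by rewrite mule_ge0.
  exact: young_sqrte.
(* The two terms of the bound are equal for c = sqrt (G / F). *)
move: ffin gfin Ifg Igg young.
case: (\int[mu]_x f x) => [F| |]// _; case: (\int[mu]_x g x) => [G| |]// _.
rewrite !lte_fin => F0 G0; have [F0' G0'] := (ltW F0, ltW G0).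
move=> /(_ (Num.sqrt (G / F))).
rewrite sqrtr_gt0 divr_gt0// => /(_ isT).
rewrite !poweR_EFin !powR12_sqrt// -!EFinM -EFinD => young.
rewrite -(@lee_pmul2l _ 2%:E)// (le_trans young)// -EFinM lee_fin.
rewrite sqrtrM// sqrtrV//.
have sF : (Num.sqrt F != 0)%R by rewrite gt_eqF// sqrtr_gt0.
have sG : (Num.sqrt G != 0)%R by rewrite gt_eqF// sqrtr_gt0.
rewrite -{2}(sqr_sqrtr F0') -{3}(sqr_sqrtr G0').
by rewrite le_eqVlt; apply/orP; left; apply/eqP; field; rewrite sF sG.
Qed.

Lemma integral_hoelder_442 (f g h : T -> \bar R) :
  measurable_fun setT f -> measurable_fun setT g -> measurable_fun setT h ->
  (forall x, 0 <= f x) -> (forall x, 0 <= g x) -> (forall x, 0 <= h x) ->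
  \int[mu]_x (f x `^ 4^-1 * g x `^ 4^-1 * h x `^ 2^-1) <=
  (\int[mu]_x f x) `^ 4^-1 * (\int[mu]_x g x) `^ 4^-1 *
  (\int[mu]_x h x) `^ 2^-1.
Proof.
move=> mf mg mh f0 g0 h0.
have quarter (x : \bar R) : x `^ 4^-1 = (x `^ 2^-1) `^ 2^-1.
  by rewrite -poweRrM -invfM -natrM.
pose fg x := f x `^ 2^-1 * g x `^ 2^-1.
have fg0 x : 0 <= fg x by rewrite mule_ge0 ?poweR_ge0.
under eq_integral => x _.
  rewrite 2!quarter -poweRM ?poweR_ge0// -/(fg x); over.
have mfg : measurable_fun setT fg.
  by apply: emeasurable_funM; exact: emeasurable_fun_poweR.
apply: (le_trans (integral_cauchy_schwarz mfg mh fg0 h0)).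
apply: lee_wpmul2r; first exact: poweR_ge0.
rewrite 2!quarter -poweRM ?poweR_ge0//.
apply: gt0_ler_poweR; rewrite ?invr_ge0 ?in_itv//= ?leey ?andbT.
- exact: integral_ge0.
- by rewrite mule_ge0 ?poweR_ge0.
- exact: integral_cauchy_schwarz.
Qed.

End integral_hoelder.

(** * Sums over a countable index set under the integral *)

Section integral_esum.
Local Open Scope ereal_scope.

(** Turns a sum over a countable type into a series over [nat], to which
    monotone convergence applies. *)
Lemma esum_countType (R : realType) (I : countType) (a : I -> \bar R) :
  (forall i, 0 <= a i) ->
  \esum_(i in [set: I]) a i = \sum_(n <oo) oapp a 0 (pickle_inv n).
Proof.
move=> a0; rewrite nneseries_esumT; last by move=> n; case: pickle_inv.
rewrite (esumID (range (@pickle I)) [set: nat]); last first.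
  by move=> n _; case: pickle_inv.
rewrite !setTI [X in _ = _ + X]esum1 ?adde0; last first.
  move=> n nI; case: (pickle_inv n) (@pickle_invK I n) => //= i ni.
  by exfalso; apply: nI; exists i.
rewrite esum_image/=; last by move=> i j _ _; exact: (pcan_inj pickleK).
by apply: eq_esum => i _; rewrite pickleK_inv.
Qed.

Context d (T : measurableType d) (R : realType) (I : countType).
Variable mu : {measure set T -> \bar R}.
Variable f : I -> T -> \bar R.
Hypothesis f0 : forall i x, 0 <= f i x.
Hypothesis mf : forall i, measurable_fun setT (f i).

Let fn n x := oapp (f ^~ x) 0 (pickle_inv n : option I).

Let fn0 n x : 0 <= fn n x.
Proof. by rewrite /fn; case: pickle_inv => //= i; exact: f0. Qed.

Let mfn n : measurable_fun setT (fn n).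
Proof. by rewrite /fn; case: pickle_inv => //= i; exact: f0. Qed.

Lemma emeasurable_fun_esum :
  measurable_fun setT (fun x => \esum_(i in [set: I]) f i x).
Proof.
under eq_fun do rewrite esum_countType//.
exact: (@ge0_emeasurable_sum _ _ _ setT fn xpredT (fun k x _ _ => fn0 k x)
  (fun k _ => @mfn k)).
Qed.

Lemma integral_esum : \int[mu]_x (\esum_(i in [set: I]) f i x) =
  \esum_(i in [set: I]) (\int[mu]_x f i x).
Proof.
rewrite (eq_integral (fun x => \sum_(n <oo) fn n x)); last first.
  by move=> x _; rewrite esum_countType.
rewrite integral_nneseries// esum_countType; last first.
  by move=> i; exact: integral_ge0.
apply: eq_eseriesr => n _; rewrite /fn; case: pickle_inv => //=.
exact: integral0_eq.
Qed.

End integral_esum.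

Local Notation rsummable f := (summable [set: _] (EFin \o f)).

(** * Absolutely convergent real sums over a countable type *)

Section usum_theory.
Variables (R : realType) (I : countType).
Implicit Types (f g p q : I -> R) (c : R).

Lemma esumZl (a : I -> \bar R) c : 0 <= c -> (forall i, 0 <= a i)%E ->
  (\esum_(i in [set: I]) (c%:E * a i) = c%:E * \esum_(i in [set: I]) a i)%E.
Proof.
move=> c0 a0; rewrite !esum_countType//; last first.
  by move=> i; rewrite mule_ge0.
rewrite -nneseriesZl//; last by move=> n _; case: pickle_inv.
apply: eq_eseriesr => n _; case: pickle_inv => //=.
by rewrite mule0.
Qed.

Lemma esum_exchange (J : countType) (a : I -> J -> \bar R) :
  (forall i j, 0 <= a i j)%E ->
  (\esum_(i in [set: I]) \esum_(j in [set: J]) a i j =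
   \esum_(j in [set: J]) \esum_(i in [set: I]) a i j)%E.
Proof.
move=> a0; rewrite (@esum_esum _ _ _ _ (fun=> setT))//.
rewrite (@esum_esum _ _ _ _ (fun=> setT) (fun j i => a i j))//.
rewrite (reindex_esum (setT `*`` (fun=> setT)) _ (fun x : J * I => (x.2, x.1)))//.
split=> //=.
- by move=> [i1 i2] [j1 j2] /= _ _ [] -> ->.
- by move=> [i j] _; exists (j, i).
Qed.

Lemma ge0_rsummable f : (forall i, 0 <= f i) ->
  (\esum_(i in [set: I]) (f i)%:E < +oo)%E -> rsummable f.
Proof.
move=> f0; apply: le_lt_trans; apply: le_esum => i _ /=.
by rewrite ger0_norm.
Qed.

Lemma rsummable_lty f : (forall i, 0 <= f i) ->
  rsummable f -> (\esum_(i in [set: I]) (f i)%:E < +oo)%E.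
Proof.
move=> f0; apply: le_lt_trans; apply: le_esum => i _ /=.
by rewrite ger0_norm.
Qed.

Lemma ge0_usum f : (forall i, 0 <= f i) ->
  usum f = fine (\esum_(i in [set: I]) (f i)%:E)%E.
Proof.
move=> f0; rewrite /usum [X in _ - fine X]esum1 ?subr0; last first.
  move=> i _; rewrite (@ge0_funenegE _ _ setT)// ?inE//.
  by move=> j _; rewrite lee_fin.
congr fine; apply: eq_esum => i _; rewrite (@ge0_funeposE _ _ setT) ?inE//.
by move=> j _; rewrite lee_fin.
Qed.

Lemma ge0_usumE f : (forall i, 0 <= f i) -> rsummable f ->
  (\esum_(i in [set: I]) (f i)%:E)%E = (usum f)%:E.
Proof.
move=> f0 sf; rewrite ge0_usum// fineK// ge0_fin_numE; last first.
  by apply: esum_ge0 => i _; rewrite lee_fin.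
exact: rsummable_lty.
Qed.

Lemma le_esum_term (a : I -> \bar R) i : (forall i, 0 <= a i)%E ->
  (a i <= \esum_(k in [set: I]) a k)%E.
Proof.
move=> a0; apply: esum_ge; exists [set i]; last by rewrite fsbig_set1.
by split => //; exact: finite_set1.
Qed.

Lemma esum_EFin_cases f : (forall i, 0 <= f i) ->
  (\esum_(i in [set: I]) (f i)%:E = +oo)%E \/
  rsummable f /\ (\esum_(i in [set: I]) (f i)%:E)%E = (usum f)%:E.
Proof.
move=> f0; have [?|foo] := eqVneq (\esum_(i in [set: I]) (f i)%:E)%E +oo%E.
  by left.
have sf : rsummable f by apply: ge0_rsummable => //; rewrite ltey.
by right; split=> //; exact: ge0_usumE.
Qed.

Lemma rsummable_le f g : (forall i, `|f i| <= g i) -> rsummable g ->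
  rsummable f.
Proof.
move=> fg; apply: le_lt_trans; apply: le_esum => i _ /=.
by rewrite lee_fin (le_trans (fg i))// ler_norm.
Qed.

Lemma rsummable_norm f : rsummable f -> rsummable (fun i => `|f i|).
Proof.
by apply: le_lt_trans; apply: le_esum => i _ /=; rewrite normr_id.
Qed.

Lemma rsummableD f g : rsummable f -> rsummable g ->
  rsummable (fun i => f i + g i).
Proof. exact: summableD. Qed.

Lemma rsummableB f g : rsummable f -> rsummable g ->
  rsummable (fun i => f i - g i).
Proof. exact: summableB. Qed.

Lemma rsummableZ c f : rsummable f -> rsummable (fun i => c * f i).
Proof.
move=> sf; rewrite /summable.
rewrite (eq_esum (b := fun i => `|c|%:E * `|(f i)%:E|)%E); last first.
  by move=> i _ /=; rewrite normrM EFinM.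
by rewrite esumZl// lte_mul_pinfty// ?lee_fin.
Qed.

Lemma rsummable0 : rsummable ((fun=> 0) : I -> R).
Proof. by rewrite /summable esum1// => i _ /=; rewrite normr0. Qed.

Lemma rsummable_sum (J : Type) (s : seq J) (F : J -> I -> R) :
  (forall j, rsummable (F j)) -> rsummable (fun i => \sum_(j <- s) F j i).
Proof.
move=> sF; elim: s => [|j s IH].
  by under eq_fun do rewrite /= big_nil; exact: rsummable0.
by under eq_fun do rewrite /= big_cons; exact: rsummableD.
Qed.

(** [usum] is defined through positive and negative parts; linearity comes from
    the fact that any other splitting into nonnegative summable families has
    the same value. *)
Lemma usum_posneg p q : (forall i, 0 <= p i) -> (forall i, 0 <= q i) ->
  rsummable p -> rsummable q -> usum (fun i => p i - q i) = usum p - usum q.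
Proof.
move=> p0 q0 sp sq; apply: EFin_inj.
rewrite [RHS]EFinB -(ge0_usumE p0 sp) -(ge0_usumE q0 sq) -esumB//;
  try by move=> i _; rewrite lee_fin.
have spq := rsummableB sp sq.
have fin (h : I -> \bar R) : (forall i, 0 <= h i)%E -> summable setT h ->
    (\esum_(i in [set: I]) h i \is a fin_num)%E.
  move=> h0; rewrite summableE; congr (_ \is a fin_num).
  by apply: eq_esum => i _; rewrite gee0_abs.
rewrite /usum EFinB !fineK//; apply: fin => //.
- exact: summable_funeneg.
- exact: summable_funepos.
Qed.

Let usum_pn f : usum f =
  usum (fun i => Num.max (f i) 0) - usum (fun i => Num.max (- f i) 0).
Proof.
rewrite [in LHS]/usum !ge0_usum//; try by move=> i; rewrite le_max lexx orbT.
by congr (fine _ - fine _); apply: eq_esum => i _;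
  rewrite ?funeposE ?funenegE/= -?EFinN EFin_max.
Qed.

Let smax f : rsummable f -> rsummable (fun i => Num.max (f i) 0).
Proof.
move=> /rsummable_norm; apply: rsummable_le => i.
by rewrite ger0_norm ?le_max ?lexx ?orbT// ge_max ler_norm normr_ge0.
Qed.

Let smaxN f : rsummable f -> rsummable (fun i => Num.max (- f i) 0).
Proof.
move=> /rsummable_norm; apply: rsummable_le => i.
by rewrite ger0_norm ?le_max ?lexx ?orbT// ge_max -normrN ler_norm normr_ge0.
Qed.

Let ge0_usumD f g : (forall i, 0 <= f i) -> (forall i, 0 <= g i) ->
  rsummable f -> rsummable g -> usum (fun i => f i + g i) = usum f + usum g.
Proof.
move=> f0 g0 sf sg; apply: EFin_inj; rewrite [RHS]EFinD.
rewrite -(ge0_usumE f0 sf) -(ge0_usumE g0 sg) -esumD//;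
  try by move=> i _; rewrite lee_fin.
rewrite -[LHS]ge0_usumE//; first by move=> i; rewrite addr_ge0.
exact: rsummableD.
Qed.

Lemma usumD f g : rsummable f -> rsummable g ->
  usum (fun i => f i + g i) = usum f + usum g.
Proof.
move=> sf sg; rewrite (usum_pn f) (usum_pn g).
have max0 (h : I -> R) i : 0 <= Num.max (h i) 0 by rewrite le_max lexx orbT.
rewrite addrACA -opprD -!ge0_usumD//; try exact: smax; try exact: smaxN;
  try exact: (max0 (fun i => - f i)); try exact: (max0 (fun i => - g i)).
rewrite -usum_posneg//; try by move=> i; rewrite addr_ge0//
  ?(max0 (fun i => - f i)) ?(max0 (fun i => - g i)).
- have maxB (x : R) : Num.max x 0 - Num.max (- x) 0 = x.
    have [x0|x0] := leP 0 x; first by rewrite max_r ?subr0 // oppr_le0.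
    by rewrite max_l ?oppr_ge0 ?ltW// sub0r opprK.
  by congr usum; apply/funext => i; rewrite opprD addrACA !maxB.
- by apply: rsummableD; exact: smax.
- by apply: rsummableD; exact: smaxN.
Qed.

Lemma usumN f : usum (fun i => - f i) = - usum f.
Proof.
rewrite (usum_pn (fun i => - f i)) (usum_pn f) [RHS]opprB; congr (_ - _).
by congr usum; apply/funext => i; rewrite opprK.
Qed.

Lemma usumB f g : rsummable f -> rsummable g ->
  usum (fun i => f i - g i) = usum f - usum g.
Proof.
move=> sf sg; rewrite usumD ?usumN//.
by under eq_fun do rewrite -mulN1r; exact: rsummableZ.
Qed.

Let ge0_usumZ c f : 0 <= c -> usum (fun i => c * f i) = c * usum f.
Proof.
move=> c0; rewrite (usum_pn (fun i => c * f i)) (usum_pn f) mulrBr.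
have max0 (h : I -> R) i : 0 <= Num.max (h i) 0 by rewrite le_max lexx orbT.
have key (h : I -> R) : (forall i, 0 <= h i) ->
    usum (fun i => c * h i) = c * usum h.
  move=> h0; rewrite !ge0_usum//; last by move=> i; rewrite mulr_ge0.
  under eq_esum do rewrite EFinM.
  rewrite esumZl//.
  have [->|cn0] := eqVneq c 0; first by rewrite mul0e mul0r.
  have [fin|nfin] := boolP (\esum_(i in [set: I]) (h i)%:E \is a fin_num)%E.
    by rewrite fineM.
  have /eqP -> : (\esum_(i in [set: I]) (h i)%:E)%E == +oo%E.
    move: nfin; rewrite ge0_fin_numE ?ltey ?negbK//.
    by apply: esum_ge0 => i _; rewrite lee_fin.
  by rewrite gt0_muley ?lte_fin ?lt0r ?cn0//= mulr0.
rewrite -(key _ (max0 f)) -(key _ (max0 (fun i => - f i))).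
by congr (_ - _); congr usum; apply/funext => i;
  rewrite maxr_pMr// mulr0 ?mulrN.
Qed.

Lemma usumZ c f : usum (fun i => c * f i) = c * usum f.
Proof.
have [c0|c0] := leP 0 c; first exact: ge0_usumZ.
rewrite -[in RHS](opprK c) mulNr -ge0_usumZ ?oppr_ge0 ?ltW// -usumN.
by congr usum; apply/funext => i; rewrite mulNr opprK.
Qed.

Lemma usum0 : usum ((fun=> 0) : I -> R) = 0.
Proof.
have := usumZ 0 ((fun=> 0) : I -> R).
by under eq_fun do rewrite mul0r; rewrite mul0r.
Qed.

Lemma usum_neq0_inhabited f : usum f != 0 -> inhabited I.
Proof.
move=> f0; apply: contrapT => nI; move/eqP: f0; apply.
rewrite -usum0; congr usum; apply/funext => i.
by exfalso; apply: nI; exists.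
Qed.

Lemma usum_ge0 f : (forall i, 0 <= f i) -> 0 <= usum f.
Proof.
by move=> f0; rewrite ge0_usum// fine_ge0// esum_ge0// => i _; rewrite lee_fin.
Qed.

Lemma ler_usum f g : rsummable f -> rsummable g -> (forall i, f i <= g i) ->
  usum f <= usum g.
Proof.
move=> sf sg fg; rewrite -subr_ge0 -usumB// usum_ge0// => i.
by rewrite subr_ge0.
Qed.

Lemma ler_usum_term f i : (forall i, 0 <= f i) -> rsummable f -> f i <= usum f.
Proof.
move=> f0 sf; rewrite -lee_fin -ge0_usumE//.
by apply: (le_esum_term (a := EFin \o f)) => k; rewrite lee_fin.
Qed.

Lemma normr_usum f : rsummable f -> `|usum f| <= usum (fun i => `|f i|).
Proof.
move=> sf; have sn := rsummable_norm sf.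
rewrite ler_norml -usumN; apply/andP; split; last first.
  by apply: ler_usum => // i; exact: ler_norm.
apply: ler_usum => // [|i]; last by rewrite lerNl -normrN ler_norm.
by under eq_fun do rewrite -mulN1r; exact: rsummableZ.
Qed.

Lemma usum_sum (J : Type) (s : seq J) (F : J -> I -> R) :
  (forall j, rsummable (F j)) ->
  usum (fun i => \sum_(j <- s) F j i) = \sum_(j <- s) usum (F j).
Proof.
move=> sF; elim: s => [|j s IH].
  by rewrite big_nil; under eq_fun do rewrite big_nil; exact: usum0.
rewrite big_cons -IH; under eq_fun do rewrite big_cons.
by rewrite usumD//; exact: rsummable_sum.
Qed.

End usum_theory.

Section discrete_cauchy_schwarz.
Variables (R : realType) (I : countType).
Implicit Types (a b p : I -> R).

Lemma discriminant_le (A B X : R) : 0 <= B ->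
  (forall c, 0 <= A - 2 * c * X + c ^+ 2 * B) -> X ^+ 2 <= A * B.
Proof.
rewrite le_eqVlt => /predU1P[<- h|B0 /(_ (X / B))].
  rewrite mulr0; have [->|Xn0] := eqVneq X 0; first by rewrite expr0n.
  have := h ((A + 1) / (2 * X)).
  have -> : A - 2 * ((A + 1) / (2 * X)) * X + ((A + 1) / (2 * X)) ^+ 2 * 0 = -1.
    by field.
  by rewrite oppr_ge0 ler10.
have -> : A - 2 * (X / B) * X + (X / B) ^+ 2 * B = (A * B - X ^+ 2) / B.
  by field; rewrite gt_eqF.
by rewrite pmulr_lge0 ?invr_gt0// subr_ge0.
Qed.

(** The quadratic [c |-> \sum p (a - c b)^2] is nonnegative; Young's inequality
    provides the absolute convergence of the mixed sum. *)
Lemma usum_cauchy_schwarz p a b : (forall i, 0 <= p i) ->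
  rsummable (fun i => p i * a i ^+ 2) -> rsummable (fun i => p i * b i ^+ 2) ->
  rsummable (fun i => p i * (a i * b i)) /\
  usum (fun i => p i * (a i * b i)) ^+ 2 <=
  usum (fun i => p i * a i ^+ 2) * usum (fun i => p i * b i ^+ 2).
Proof.
move=> p0 sa sb.
have sab : rsummable (fun i => p i * (a i * b i)).
  apply: rsummable_le (rsummableD sa sb) => i.
  rewrite -mulrDr normrM ger0_norm// ler_wpM2l// normrM.
  rewrite -(real_normK (num_real (a i))) -(real_normK (num_real (b i))).
  by have := normr_ge0 (a i); have := normr_ge0 (b i); nra.
split=> //; apply: discriminant_le => [|c].
  by apply: usum_ge0 => i; rewrite mulr_ge0// sqr_ge0.
rewrite -!usumZ -usumB//; last exact: rsummableZ.
rewrite -usumD; last 2 first.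
- by apply: rsummableB => //; exact: rsummableZ.
- exact: rsummableZ.
apply: usum_ge0 => i.
have -> : p i * a i ^+ 2 - 2 * c * (p i * (a i * b i)) +
  c ^+ 2 * (p i * b i ^+ 2) = p i * (a i - c * b i) ^+ 2 by ring.
by rewrite mulr_ge0// sqr_ge0.
Qed.

(** Cauchy-Schwarz against the constant family 1. *)
Lemma usum_sqr_le p a : (forall i, 0 <= p i) -> rsummable p ->
  rsummable (fun i => p i * a i ^+ 2) ->
  rsummable (fun i => p i * a i) /\
  usum (fun i => p i * a i) ^+ 2 <= usum p * usum (fun i => p i * a i ^+ 2).
Proof.
move=> p0 sp sa.
have := @usum_cauchy_schwarz p (fun=> 1) a p0.
under eq_fun do rewrite expr1n mulr1.
by under [in X in _ -> _ -> X]eq_fun do rewrite mul1r; exact.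
Qed.

End discrete_cauchy_schwarz.

(** * The two pointwise inequalities *)

Section pointwise.
Variables (R : realType) (I : countType) (d : nat).
Implicit Types (q u r w : I -> R) (V s : I -> 'rV[R]_d).

Lemma sqnorm_ge0 (x : 'rV[R]_d) : 0 <= sqnorm x.
Proof. by apply: sumr_ge0 => j _; exact: sqr_ge0. Qed.

Lemma sqr_le_sqnorm (x : 'rV[R]_d) j : x ord0 j ^+ 2 <= sqnorm x.
Proof.
by rewrite /sqnorm (bigD1 j)//= lerDl sumr_ge0// => k _; exact: sqr_ge0.
Qed.

Lemma sqnorm_usum_ge0 V : (0 <= sqnorm_usum V)%E.
Proof. by rewrite /sqnorm_usum; case: ifP => // _; rewrite lee_fin sqnorm_ge0. Qed.

Lemma sqnorm_usumE V :
  (forall j, rsummable (fun i => V i ord0 j)) ->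
  sqnorm_usum V = (\sum_(j < d) usum (fun i => V i ord0 j) ^+ 2)%:E.
Proof.
move=> sV; rewrite /sqnorm_usum asboolT// /sqnorm.
by congr EFin; apply: eq_bigr => j _; rewrite mxE.
Qed.

(** Cauchy-Schwarz in each coordinate.  Either the right-hand side is infinite,
    or its finiteness gives the absolute convergence without which
    [sqnorm_usum] is infinite. *)
Lemma jensen_sqnorm_usum q V : (forall i, 0 <= q i) -> rsummable q ->
  0 < usum q ->
  ((usum q)%:E * sqnorm_usum (fun i => (q i / usum q) *: V i) <=
   \esum_(i in [set: I]) (q i * sqnorm (V i))%:E)%E.
Proof.
move=> q0 sq rho0.
have qV0 i : 0 <= q i * sqnorm (V i) by rewrite mulr_ge0 ?sqnorm_ge0.
have [->|[sV ->]] := esum_EFin_cases qV0; first exact: leey.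
have sV2 j : rsummable (fun i => q i * V i ord0 j ^+ 2).
  apply: rsummable_le sV => i.
  rewrite ger0_norm; last by rewrite mulr_ge0// sqr_ge0.
  by rewrite ler_wpM2l// sqr_le_sqnorm.
have CS j := usum_sqr_le q0 sq (sV2 j).
have coordE j : (fun i => ((q i / usum q) *: V i) ord0 j) =
    (fun i => (usum q)^-1 * (q i * V i ord0 j)).
  by apply/funext => i; rewrite mxE; ring.
rewrite sqnorm_usumE => [|j]; last first.
  by rewrite coordE; apply: rsummableZ; exact: (CS j).1.
rewrite -EFinM lee_fin.
have -> : usum (fun i => q i * sqnorm (V i)) =
    \sum_(j < d) usum (fun i => q i * V i ord0 j ^+ 2).
  by rewrite -usum_sum//; congr usum; apply/funext => i; rewrite mulr_sumr.
rewrite mulr_sumr; apply: ler_sum => j _; rewrite coordE usumZ exprMn.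
have -> (x : R) : usum q * ((usum q)^-1 ^+ 2 * x) = (usum q)^-1 * x.
  by field; rewrite gt_eqF.
by rewrite ler_pdivrMl// (CS j).2.
Qed.

(** At a fixed point of the space, [q i] is the weighted density of the i-th
    component, [q i * u i] that of its perturbed version, [r i] the ratio of the
    two densities without the weights, and [s i] the perturbed score of the i-th
    component.  Thus [delta i] is the difference of the two posterior
    probabilities of [i]. *)
Section posterior_perturbation.
Variables (q u r w : I -> R) (s : I -> 'rV[R]_d) (b : R).
Hypotheses (q_gt0 : forall i, 0 < q i) (u_gt0 : forall i, 0 < u i).
Hypotheses (r_gt0 : forall i, 0 < r i) (w_gt0 : forall i, 0 < w i).
Hypotheses (b_gt0 : 0 < b) (bru : forall i, b * r i <= u i).
Hypotheses (sq : rsummable q) (squ : rsummable (fun i => q i * u i)).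
Hypotheses (sw : rsummable w) (sum_w : usum w = 1).

Let rho := usum q.
Let prho := usum (fun i => q i * u i).
Let Ds := (\esum_(i in [set: I]) (q i * (u i - 1) ^+ 8)%:E)%E.
Let Rs := (\esum_(i in [set: I]) (q i * r i ^- 8)%:E)%E.
Let Qs l := (\esum_(i in [set: I]) (q i * sqnorm (s i - s l) ^+ 2)%:E)%E.
Let Ss := (\esum_(i in [set: I]) \esum_(l in [set: I])
  (q i * w l * sqnorm (s i - s l) ^+ 2)%:E)%E.
Let delta i := q i / rho - q i * u i / prho.

Let q_ge0 i : 0 <= q i. Proof. exact: ltW. Qed.

Lemma usum_mass_gt0 (i0 : I) : 0 < rho.
Proof. by apply: lt_le_trans (q_gt0 i0) _; exact: ler_usum_term. Qed.

Lemma usum_pmass_gt0 (i0 : I) : 0 < prho.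
Proof.
have qu0 i : 0 < q i * u i by rewrite mulr_gt0.
apply: lt_le_trans (qu0 i0) _.
by apply: (@ler_usum_term _ _ (fun i => q i * u i)) => // i; exact: ltW.
Qed.

Lemma usum_delta0 (i0 : I) : rsummable delta /\ usum delta = 0.
Proof.
have rho0 := usum_mass_gt0 i0; have prho0 := usum_pmass_gt0 i0.
have sd1 : rsummable (fun i => q i / rho).
  by under eq_fun do rewrite mulrC; exact: rsummableZ.
have sd2 : rsummable (fun i => q i * u i / prho).
  by under eq_fun do rewrite mulrC; exact: rsummableZ.
split; first exact: rsummableB.
rewrite usumB//.
under [X in usum X - _]eq_fun do rewrite mulrC.
under [X in _ - usum X]eq_fun do rewrite mulrC.
by rewrite !usumZ !mulVf ?subrr// gt_eqF.
Qed.

(** Jensen's inequality for squares, iterated along the exponents 8, 4, 2, 1;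
    each step also gives the convergence of the next sum. *)
Lemma usum_power_means (x : I -> R) : rsummable (fun i => q i * x i ^+ 8) ->
  [/\ rsummable (fun i => q i * x i), rsummable (fun i => q i * x i ^+ 2),
      usum (fun i => q i * x i ^+ 2) ^+ 4 <=
        rho ^+ 3 * usum (fun i => q i * x i ^+ 8) &
      usum (fun i => q i * x i) ^+ 8 <=
        rho ^+ 7 * usum (fun i => q i * x i ^+ 8)].
Proof.
move=> s8.
have rho0 : 0 <= rho by exact: usum_ge0.
have pos k (y : I -> R) : 0 <= usum (fun i => q i * (y i ^+ k) ^+ 2).
  by apply: usum_ge0 => i; rewrite mulr_ge0// sqr_ge0.
have [s4 le4] : rsummable (fun i => q i * x i ^+ 4) /\
    usum (fun i => q i * x i ^+ 4) ^+ 2 <=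
    rho * usum (fun i => q i * x i ^+ 8).
  have := @usum_sqr_le _ _ q (fun i => x i ^+ 4) q_ge0 sq.
  by under eq_fun do rewrite -exprM; exact.
have [s2 le2] : rsummable (fun i => q i * x i ^+ 2) /\
    usum (fun i => q i * x i ^+ 2) ^+ 2 <=
    rho * usum (fun i => q i * x i ^+ 4).
  have := @usum_sqr_le _ _ q (fun i => x i ^+ 2) q_ge0 sq.
  by under eq_fun do rewrite -exprM; exact.
have [s1 le1] := usum_sqr_le q_ge0 sq s2.
have le24 : usum (fun i => q i * x i ^+ 2) ^+ 4 <=
    rho ^+ 3 * usum (fun i => q i * x i ^+ 8).
  rewrite (exprM _ 2 2) (le_trans (lerXn2r 2 _ _ le2)) ?nnegrE ?sqr_ge0//.
    rewrite mulr_ge0//; have := pos 2%N x.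
    by under eq_fun do rewrite -exprM.
  by rewrite exprMn [rho ^+ 3]exprSr -[leRHS]mulrA ler_wpM2l ?exprn_ge0.
split=> //.
rewrite (exprM _ 2 4) (le_trans (lerXn2r 4 _ _ le1)) ?nnegrE ?sqr_ge0//.
  by rewrite mulr_ge0//; have := pos 1%N x; under eq_fun do rewrite expr1.
by rewrite exprMn [rho ^+ 7](exprD _ 4 3) -mulrA ler_wpM2l ?exprn_ge0.
Qed.

(** By Cauchy-Schwarz [rho^2 <= (\sum q r) (\sum q / r)].  The first sum is at
    most [prho / b] and the second one is controlled by the power means; hence
    the mean likelihood ratio [prho / rho] is not small. *)
Lemma posterior_ratio_bound (i0 : I) : rsummable (fun i => q i * r i ^- 8) ->
  b ^+ 8 * rho ^+ 9 <= prho ^+ 8 * usum (fun i => q i * r i ^- 8).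
Proof.
move=> s8; have rho0 := usum_mass_gt0 i0; have prho0 := usum_pmass_gt0 i0.
have s8' : rsummable (fun i => q i * (r i)^-1 ^+ 8).
  by under eq_fun do rewrite /= exprVn.
have [s1 _ _] := usum_power_means s8'.
under [X in _ * usum X]eq_fun do rewrite exprVn.
move=> le8.
have rn0 i : r i != 0 by rewrite gt_eqF.
have sr : rsummable (fun i => q i * r i).
  apply: rsummable_le (rsummableZ b^-1 squ) => i.
  rewrite ger0_norm; last by rewrite mulr_ge0 ?ltW.
  by rewrite mulrCA ler_wpM2l// ler_pdivlMl.
have qrV i : q i * r i * (r i)^-1 = q i by rewrite mulfK.
have [_] : rsummable (fun i => q i * r i * (r i)^-1) /\
    usum (fun i => q i * r i * (r i)^-1) ^+ 2 <=
    usum (fun i => q i * r i) * usum (fun i => q i * r i * (r i)^-1 ^+ 2).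
  apply: usum_sqr_le => // [i|]; first by rewrite mulr_ge0 ?ltW.
  by under eq_fun do rewrite expr2 mulrA qrV.
under [X in usum X ^+ 2]eq_fun do rewrite qrV.
under [X in _ * usum X]eq_fun do rewrite expr2 mulrA qrV.
rewrite -/rho; set Y := usum (fun i => q i * r i) => leY.
set Z := usum _ in leY le8.
have Z0 : 0 <= Z by apply: usum_ge0 => i; rewrite mulr_ge0// invr_ge0 ltW.
have Y0 : 0 <= Y by apply: usum_ge0 => i; rewrite mulr_ge0 ?ltW.
have bY : b * Y <= prho.
  rewrite -usumZ ler_usum//; first exact: rsummableZ.
  by move=> i; rewrite mulrCA ler_wpM2l.
have key : rho ^+ 16 <= Y ^+ 8 * (rho ^+ 7 * usum (fun i => q i * r i ^- 8)).
  rewrite (exprM _ 2 8) (le_trans (lerXn2r 8 _ _ leY)) ?nnegrE ?sqr_ge0 ?mulr_ge0//.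
  by rewrite exprMn ler_wpM2l ?exprn_ge0.
have key' : rho ^+ 9 <= Y ^+ 8 * usum (fun i => q i * r i ^- 8).
  rewrite -(ler_pM2l (exprn_gt0 7 rho0)) -exprD (le_trans key)//.
  by rewrite mulrCA.
rewrite (le_trans (ler_wpM2l (exprn_ge0 8 (ltW b_gt0)) key'))//.
rewrite mulrA -exprMn ler_wpM2r//.
  by apply: usum_ge0 => i; rewrite mulr_ge0// invr_ge0 exprn_ge0 ?ltW.
by apply: lerXn2r => //; rewrite nnegrE ?mulr_ge0// ltW.
Qed.

(** Since [delta] has total mass zero, [s] may be recentred at any [s l].  With
    [ubar = prho / rho], the posterior mean of [u], one has
    [delta i = q i (ubar - u i) / prho], and Cauchy-Schwarz separates the factor
    [u - ubar] from the recentred scores. *)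
Lemma posterior_coord_bound (i0 l : I) (j : 'I_d) :
  rsummable (fun i => q i * (u i - 1) ^+ 2) ->
  rsummable (fun i => q i * (s i ord0 j - s l ord0 j) ^+ 2) ->
  rsummable (fun i => delta i * s i ord0 j) /\
  prho ^+ 2 * usum (fun i => delta i * s i ord0 j) ^+ 2 <=
  usum (fun i => q i * (u i - 1) ^+ 2) *
  usum (fun i => q i * (s i ord0 j - s l ord0 j) ^+ 2).
Proof.
move=> su2 ss2.
have rho0 := usum_mass_gt0 i0; have prho0 := usum_pmass_gt0 i0.
have [sd d0] := usum_delta0 i0.
pose ubar := prho / rho.
have su1 : rsummable (fun i => q i * (u i - 1)).
  by under eq_fun do rewrite mulrBr mulr1; exact: rsummableB.
have vE i : q i * (u i - ubar) ^+ 2 = q i * (u i - 1) ^+ 2 -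
    2 * (ubar - 1) * (q i * (u i - 1)) + (ubar - 1) ^+ 2 * q i by ring.
have sv : rsummable (fun i => q i * (u i - ubar) ^+ 2).
  under eq_fun do rewrite vE; apply: rsummableD; last exact: rsummableZ.
  by apply: rsummableB => //; exact: rsummableZ.
(* The second moment is smallest around the mean. *)
have le_v : usum (fun i => q i * (u i - ubar) ^+ 2) <=
    usum (fun i => q i * (u i - 1) ^+ 2).
  under [X in usum X <= _]eq_fun do rewrite vE.
  rewrite usumD; [|by apply: rsummableB => //; exact: rsummableZ
                  |exact: rsummableZ].
  rewrite usumB//; last exact: rsummableZ.
  rewrite !usumZ -/rho.
  have -> : usum (fun i => q i * (u i - 1)) = prho - rho.
    by under eq_fun do rewrite mulrBr mulr1; rewrite usumB.
  rewrite -subr_ge0 /ubar.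
  set X := usum _.
  have -> : X - (X - 2 * (prho / rho - 1) * (prho - rho) +
    (prho / rho - 1) ^+ 2 * rho) = (prho - rho) ^+ 2 / rho.
    by field; rewrite gt_eqF.
  by rewrite divr_ge0 ?sqr_ge0 ?ltW.
have [scs cs] := usum_cauchy_schwarz q_ge0 sv ss2.
have dE i : delta i * s i ord0 j =
    - prho^-1 * (q i * ((u i - ubar) * (s i ord0 j - s l ord0 j))) +
    s l ord0 j * delta i.
  by rewrite /delta /ubar; field; rewrite !gt_eqF.
split.
  by under eq_fun do rewrite dE; apply: rsummableD; exact: rsummableZ.
under eq_fun do rewrite dE.
rewrite usumD ?usumZ; [|exact: rsummableZ|exact: rsummableZ].
rewrite d0 mulr0 addr0.
have -> (x : R) : prho ^+ 2 * (- prho^-1 * x) ^+ 2 = x ^+ 2.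
  by field; rewrite gt_eqF.
rewrite (le_trans cs)// ler_wpM2r//.
by apply: usum_ge0 => i; rewrite mulr_ge0// sqr_ge0.
Qed.

Let term2_ge0 i l : 0 <= q i * sqnorm (s i - s l) ^+ 2.
Proof. by rewrite mulr_ge0// sqr_ge0. Qed.

(** [Ss] is the average of the [Qs l] under the weights [w], hence at least one
    of them.  Centring at such an [l] replaces the pairwise differences weighted
    by posterior probabilities by those weighted by [w]. *)
Lemma exists_center (i0 : I) : (Ss < +oo)%E -> exists l, (Qs l <= Ss)%E.
Proof.
have Qs0 l : (0 <= Qs l)%E by apply: esum_ge0 => i _; rewrite lee_fin.
have SsE : Ss = (\esum_(l in [set: I]) ((w l)%:E * Qs l))%E.
  rewrite /Ss esum_exchange; last first.
    by move=> i l; rewrite lee_fin mulr_ge0 ?sqr_ge0// mulr_ge0// ltW.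
  apply: eq_esum => l _.
  rewrite -esumZl; [|exact: ltW|by move=> i; rewrite lee_fin].
  by apply: eq_esum => i _; rewrite -EFinM; congr EFin; ring.
move=> Sfin; apply: contrapT => /forallNP nle.
have ltQ l : (Ss < Qs l)%E by rewrite ltNge; apply/negP/nle.
have Ss0 : (0 <= Ss)%E.
  by rewrite SsE; apply: esum_ge0 => l _; rewrite mule_ge0// lee_fin ltW.
have Qfin l : Qs l \is a fin_num.
  rewrite ge0_fin_numE//; have : ((w l)%:E * Qs l < +oo)%E.
    apply: le_lt_trans Sfin; rewrite SsE.
    apply: (le_esum_term (a := fun l => (w l)%:E * Qs l)%E) => k.
    by rewrite mule_ge0// lee_fin ltW.
  by case: (Qs l) => // [x _|]; rewrite ?ltry// gt0_muley ?lte_fin.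
pose x l := fine (Qs l); pose S := fine Ss.
have SfinE : Ss = S%:E by rewrite /S fineK// ge0_fin_numE.
have xE l : Qs l = (x l)%:E by rewrite /x fineK.
have ltx l : S < x l by rewrite -lte_fin -SfinE -xE.
have wx0 l : 0 <= w l * x l by rewrite mulr_ge0 ?fine_ge0// ltW.
have esumE : (\esum_(l in [set: I]) (w l * x l)%:E = S%:E)%E.
  by rewrite -SfinE SsE; apply: eq_esum => l _; rewrite xE EFinM.
have swx : rsummable (fun l => w l * x l).
  by apply: ge0_rsummable => //; rewrite esumE ltry.
have swS : rsummable (fun l => w l * S).
  by under eq_fun do rewrite mulrC; exact: rsummableZ.
have : w i0 * x i0 - w i0 * S <= usum (fun l => w l * x l - w l * S).
  apply: (@ler_usum_term _ _ (fun l => w l * x l - w l * S)).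
    by move=> l; rewrite -mulrBr mulr_ge0 ?subr_ge0 ?ltW.
  exact: rsummableB.
rewrite usumB// leNgt => /negP; apply.
have -> : usum (fun l => w l * x l) = S.
  by apply: EFin_inj; rewrite -ge0_usumE.
have -> : usum (fun l => w l * S) = S.
  by under eq_fun do rewrite mulrC; rewrite usumZ sum_w mulr1.
by rewrite subrr -mulrBr mulr_gt0// subr_gt0.
Qed.

(** The squared norm of the error is at most [A C / prho^2], where [A] and [C]
    are second moments; raising to the fourth power turns them into the
    eighth-power and fourth-power sums of the statement. *)
Lemma posterior_error_bound_fin (i0 l : I) :
  rsummable (fun i => q i * (u i - 1) ^+ 8) ->
  rsummable (fun i => q i * r i ^- 8) ->
  rsummable (fun i => q i * sqnorm (s i - s l) ^+ 2) ->
  exists N : R, [/\ sqnorm_usum (fun i => delta i *: s i) = N%:E, 0 <= N &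
    b ^+ 8 * (rho * N) ^+ 4 <=
    usum (fun i => q i * (u i - 1) ^+ 8) * usum (fun i => q i * r i ^- 8) *
    usum (fun i => q i * sqnorm (s i - s l) ^+ 2) ^+ 2].
Proof.
move=> sD sR sQ.
have rho0 := usum_mass_gt0 i0; have prho0 := usum_pmass_gt0 i0.
have [_ su2 leA _] := usum_power_means sD.
have [sC leC] := usum_sqr_le q_ge0 sq sQ.
have leR := posterior_ratio_bound i0 sR.
have ss2 j : rsummable (fun i => q i * (s i ord0 j - s l ord0 j) ^+ 2).
  apply: rsummable_le sC => i.
  rewrite ger0_norm; last by rewrite mulr_ge0// sqr_ge0.
  rewrite ler_wpM2l//; have := sqr_le_sqnorm (s i - s l) j.
  by rewrite !mxE.
have coord j := posterior_coord_bound i0 su2 (ss2 j).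
have dsE j : (fun i => (delta i *: s i) ord0 j) =
    (fun i => delta i * s i ord0 j) by apply/funext => i; rewrite mxE.
pose N := \sum_(j < d) usum (fun i => delta i * s i ord0 j) ^+ 2.
have N0 : 0 <= N by apply: sumr_ge0 => j _; exact: sqr_ge0.
exists N; split=> //.
  rewrite sqnorm_usumE => [|j]; last by rewrite dsE; exact: (coord j).1.
  by congr EFin; apply: eq_bigr => j _; rewrite dsE.
set A := usum (fun i => q i * (u i - 1) ^+ 2) in leA coord.
set C := usum (fun i => q i * sqnorm (s i - s l)) in leC.
set D := usum (fun i => q i * (u i - 1) ^+ 8) in leA *.
set Rr := usum (fun i => q i * r i ^- 8) in leR *.
set Q := usum (fun i => q i * sqnorm (s i - s l) ^+ 2) in leC *.
have A0 : 0 <= A by apply: usum_ge0 => i; rewrite mulr_ge0// sqr_ge0.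
have C0 : 0 <= C by apply: usum_ge0 => i; rewrite mulr_ge0// sqnorm_ge0.
have D0 : 0 <= D.
  by apply: usum_ge0 => i; rewrite mulr_ge0// (exprM _ 4 2) sqr_ge0.
have R0 : 0 <= Rr.
  by apply: usum_ge0 => i; rewrite mulr_ge0// invr_ge0 exprn_ge0// ltW.
have Q0 : 0 <= Q by apply: usum_ge0.
have NC : prho ^+ 2 * N <= A * C.
  have -> : C = \sum_(j < d) usum (fun i => q i * (s i ord0 j - s l ord0 j) ^+ 2).
    rewrite -usum_sum//; congr usum; apply/funext => i.
    by rewrite -mulr_sumr; congr (_ * _); apply: eq_bigr => j _; rewrite !mxE.
  by rewrite /N !mulr_sumr; apply: ler_sum => j _; exact: (coord j).2.
have NC4 : prho ^+ 8 * N ^+ 4 <= A ^+ 4 * C ^+ 4.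
  rewrite (exprM prho 2 4) -!exprMn lerXn2r// nnegrE mulr_ge0//.
  exact: sqr_ge0.
have C4 : C ^+ 4 <= rho ^+ 2 * Q ^+ 2.
  by rewrite (exprM C 2 2) -exprMn lerXn2r// nnegrE ?sqr_ge0 ?mulr_ge0// ltW.
have AC : A ^+ 4 * C ^+ 4 <= (rho ^+ 3 * D) * (rho ^+ 2 * Q ^+ 2).
  by rewrite ler_pM// exprn_ge0.
have p8 : 0 < prho ^+ 8 by rewrite exprn_gt0.
rewrite -(ler_pM2l p8).
have -> : prho ^+ 8 * (b ^+ 8 * (rho * N) ^+ 4) =
  (b ^+ 8 * rho ^+ 4) * (prho ^+ 8 * N ^+ 4) by ring.
apply: (@le_trans _ _ ((b ^+ 8 * rho ^+ 4) *
    ((rho ^+ 3 * D) * (rho ^+ 2 * Q ^+ 2)))).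
  rewrite ler_wpM2l ?(le_trans NC4)// mulr_ge0 ?exprn_ge0 //; exact: ltW.
have -> : b ^+ 8 * rho ^+ 4 * (rho ^+ 3 * D * (rho ^+ 2 * Q ^+ 2)) =
  (b ^+ 8 * rho ^+ 9) * (D * Q ^+ 2) by ring.
have -> : prho ^+ 8 * (D * Rr * Q ^+ 2) = (prho ^+ 8 * Rr) * (D * Q ^+ 2) by ring.
by rewrite ler_wpM2r// mulr_ge0// sqr_ge0.
Qed.

Lemma quarter_power_bound (D Rr Q X : R) : 0 <= D -> 0 <= Rr -> 0 <= Q ->
  0 <= X -> b ^+ 8 * X ^+ 4 <= D * Rr * Q ^+ 2 ->
  X <= b ^- 2 * D `^ 4^-1 * Rr `^ 4^-1 * Q `^ 2^-1.
Proof.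
move=> D0 R0 Q0 X0 le4.
have root4 (x : R) : 0 <= x -> (x ^+ 4) `^ 4^-1 = x.
  by move=> x0; rewrite -powR_mulrn// -powRrM mulfV// powRr1.
have -> : Q `^ 2^-1 = (Q ^+ 2) `^ 4^-1.
  by rewrite -powR_mulrn// -powRrM; congr (_ `^ _); field.
rewrite -!mulrA ler_pdivlMl ?exprn_gt0//.
rewrite -(root4 (b ^+ 2 * X)); last by rewrite mulr_ge0// sqr_ge0.
rewrite -!powRM ?sqr_ge0//; last by rewrite mulr_ge0// sqr_ge0.
have pos : 0 <= D * (Rr * Q ^+ 2) by rewrite !mulr_ge0// sqr_ge0.
apply: ge0_ler_powR; rewrite ?nnegrE ?invr_ge0//.
  by rewrite exprn_ge0// mulr_ge0// sqr_ge0.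
by rewrite exprMn -exprM mulrA.
Qed.

(** As [0 * +oo = 0], an infinite factor makes the bound trivial only if no other
    factor vanishes.  If [Ds = 0] the two posteriors coincide, and if [Ss = 0]
    all the scores coincide; the error is zero in both cases. *)
Lemma posterior_error_bound :
  (rho%:E * sqnorm_usum (fun i => delta i *: s i) <=
   (b ^- 2)%:E * Ds `^ 4^-1 * Rs `^ 4^-1 * Ss `^ 2^-1)%E.
Proof.
have [i0] : inhabited I.
  by apply: (@usum_neq0_inhabited R I w); rewrite sum_w oner_neq0.
have rho0 := usum_mass_gt0 i0; have prho0 := usum_pmass_gt0 i0.
have b2 : (0 < (b ^- 2)%:E)%E by rewrite lte_fin invr_gt0 exprn_gt0.
have D0 i : 0 <= q i * (u i - 1) ^+ 8.
  by rewrite mulr_ge0// (exprM _ 4 2) sqr_ge0.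
have R0 i : 0 < q i * r i ^- 8 by rewrite mulr_gt0// invr_gt0 exprn_gt0.
have S0 i l : 0 <= q i * w l * sqnorm (s i - s l) ^+ 2.
  by rewrite mulr_ge0 ?sqr_ge0// mulr_ge0// ltW.
have Ds0 : (0 <= Ds)%E by apply: esum_ge0 => i _; rewrite lee_fin.
have Ss0 : (0 <= Ss)%E.
  by apply: esum_ge0 => i _; apply: esum_ge0 => l _; rewrite lee_fin.
have Rs0 : (0 < Rs)%E.
  apply: (@lt_le_trans _ _ (q i0 * r i0 ^- 8)%:E); first by rewrite lte_fin.
  apply: (le_esum_term (a := fun i => (q i * r i ^- 8)%:E)) => i.
  by rewrite lee_fin ltW.
have rhs0 : (0 <= (b ^- 2)%:E * Ds `^ 4^-1 * Rs `^ 4^-1 * Ss `^ 2^-1)%E.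
  by rewrite !mule_ge0 ?poweR_ge0// ltW.
have zero : (forall j, usum (fun i => delta i * s i ord0 j) = 0) ->
    (forall j, rsummable (fun i => delta i * s i ord0 j)) ->
    sqnorm_usum (fun i => delta i *: s i) = 0%E.
  have dsE j : (fun i => (delta i *: s i) ord0 j) =
    (fun i => delta i * s i ord0 j) by apply/funext => i; rewrite mxE.
  move=> z sz; rewrite sqnorm_usumE => [|j]; last by rewrite dsE.
  by congr EFin; apply: big1 => j _; rewrite dsE z expr0n.
have [Dz|Dn0] := eqVneq Ds 0%E.
  have u1 i : u i = 1.
    have := le_esum_term (a := fun i => (q i * (u i - 1) ^+ 8)%:E) i
      (fun k => D0 k).
    rewrite -/Ds Dz lee_fin => le0.
    have /eqP : q i * (u i - 1) ^+ 8 = 0 by apply/le_anti; rewrite le0 D0.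
    rewrite mulf_eq0 gt_eqF//= expf_eq0/= subr_eq0 => /eqP//.
  have d0 i : delta i = 0.
    have prhoE : prho = rho.
      by congr usum; apply/funext => k; rewrite u1 mulr1.
    by rewrite /delta prhoE u1 mulr1 subrr.
  rewrite zero ?mule0// => j; under eq_fun do rewrite d0 mul0r.
    exact: usum0.
  exact: rsummable0.
have [Sz|Sn0] := eqVneq Ss 0%E.
  have sE i : s i = s i0.
    have le0 : (q i * w i0 * sqnorm (s i - s i0) ^+ 2 <= 0).
      rewrite -lee_fin -[leRHS]/(0%E) -Sz.
      apply: le_trans (le_esum_term (a := fun i => \esum_(l in [set: I])
        (q i * w l * sqnorm (s i - s l) ^+ 2)%:E)%E i _); last first.
        by move=> k; apply: esum_ge0 => l _; rewrite lee_fin.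
      apply: (le_esum_term (a := fun l =>
        (q i * w l * sqnorm (s i - s l) ^+ 2)%:E)) => l.
      by rewrite lee_fin.
    have /eqP : q i * w i0 * sqnorm (s i - s i0) ^+ 2 = 0.
      by apply/le_anti; rewrite le0 S0.
    rewrite mulf_eq0 gt_eqF ?mulr_gt0//= expf_eq0/= => /eqP n0.
    apply/rowP => j; apply/eqP; rewrite -subr_eq0 -sqrf_eq0 eq_le sqr_ge0 andbT.
    by have := sqr_le_sqnorm (s i - s i0) j; rewrite n0 !mxE.
  have [sd d0] := usum_delta0 i0.
  rewrite zero ?mule0// => j; under eq_fun do rewrite sE mulrC.
    by rewrite usumZ d0 mulr0.
  exact: rsummableZ.
have Dgt : (0 < Ds)%E by rewrite lt0e Dn0.
have Sgt : (0 < Ss)%E by rewrite lt0e Sn0.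
(* From here on no factor vanishes, and an infinite one gives the result. *)
have [Doo|[sD DE]] := esum_EFin_cases D0.
  rewrite /Ds Doo poweRyr ?invr_eq0// [X in (_ <= X * _ * _)%E]gt0_muley//.
  by rewrite gt0_mulye ?poweR_gt0// gt0_mulye ?leey// poweR_gt0.
have [Roo|[sR RE]] := esum_EFin_cases (fun i => ltW (R0 i)).
  rewrite /Rs Roo [X in (_ <= _ * X * _)%E]poweRyr ?invr_eq0//.
  rewrite [X in (_ <= X * _)%E]gt0_muley ?mule_gt0 ?poweR_gt0//.
  by rewrite gt0_mulye ?leey// poweR_gt0.
have [Soo|Sfin] := eqVneq Ss +oo%E.
  rewrite Soo [X in (_ <= _ * X)%E]poweRyr ?invr_eq0//.
  by rewrite gt0_muley ?leey// !mule_gt0 ?poweR_gt0.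
have [l leQ] : exists l, (Qs l <= Ss)%E by apply: exists_center; rewrite ?ltey.
have [Qoo|[sQ QE]] := esum_EFin_cases (fun i => term2_ge0 i l).
  by move: leQ; rewrite /Qs Qoo leye_eq (negbTE Sfin).
have [N [-> N0 leN]] := posterior_error_bound_fin i0 sD sR sQ.
have Q0 : 0 <= usum (fun i => q i * sqnorm (s i - s l) ^+ 2) by exact: usum_ge0.
apply: (@le_trans _ _ ((b ^- 2)%:E * Ds `^ 4^-1 * Rs `^ 4^-1 * (Qs l) `^ 2^-1)%E);
    last first.
  apply: lee_wpmul2l; first by rewrite !mule_ge0 ?poweR_ge0// ltW.
  apply: gt0_ler_poweR; rewrite ?invr_ge0 ?in_itv//= ?leey ?andbT//.
  by rewrite /Qs QE lee_fin.
rewrite /Ds DE /Rs RE /Qs QE !poweR_EFin -!EFinM lee_fin.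
apply: quarter_power_bound => //.
- exact: usum_ge0.
- by apply: usum_ge0 => i; exact: ltW.
- by rewrite mulr_ge0// ltW.
Qed.

End posterior_perturbation.
End pointwise.

(** * Gaussian moments on the real line *)

Section lebesgue_reflection.
Context {R : realType}.
Local Open Scope ereal_scope.
Local Notation mu := (@lebesgue_measure R).

Let refl (c : R) : measurableTypeR R -> measurableTypeR R := fun x => (c - x)%R.

Let measurable_refl c : measurable_fun setT (refl c).
Proof. by apply: measurable_funB => //; exact: measurable_cst. Qed.

Let lebesgue_measure_refl c (A : set R) : measurable A ->
  pushforward mu (refl c) A = mu A.
Proof.
pose nu := pushforward mu (refl c).
have nu0 : nu set0 = 0 by rewrite /nu /pushforward preimage_set0 measure0.
move=> mA; apply/esym/lebesgue_measure_unique => //= _ [[a b]] _ <-.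
rewrite /pushforward.
have -> : refl c @^-1` `]a, b]%classic = `[(c - b)%R, (c - a)%R[%classic.
  by apply/seteqP; split=> x /=; rewrite /refl !in_itv/= => /andP[h1 h2];
    apply/andP; split; lra.
rewrite !lebesgue_measure_itv/= !lte_fin.
have -> : (c - b < c - a)%R = (a < b)%R by rewrite ltrD2l ltrN2.
by case: ifPn => // _; rewrite -!EFinB; congr EFin; ring.
Qed.

Lemma ge0_integral_refl c (f : R -> \bar R) :
  measurable_fun setT f -> (forall x, 0 <= f x) ->
  \int[mu]_x f (c - x)%R = \int[mu]_x f x.
Proof.
move=> mf f0; rewrite -[LHS](ge0_integral_pushforward (measurable_refl c) mu
  measurableT mf (fun x _ => f0 x)).
by apply: eq_measure_integral => //= A mA _; exact: lebesgue_measure_refl.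
Qed.

End lebesgue_reflection.

Section exponential_inequalities.
Variable R : realType.
Implicit Types x t : R.

Lemma expR_ge_quadratic x : 0 <= x -> 1 + x + x ^+ 2 / 2 <= expR x.
Proof.
move=> x0; rewrite /expR.
have -> : 1 + x + x ^+ 2 / 2 = series (exp_coeff x) 3%N.
  rewrite /series/= !big_nat_recr//= big_nil /exp_coeff/=.
  by rewrite expr0 expr1 !factS fact0; field.
apply: nondecreasing_cvgn_le; last exact: is_cvg_series_exp_coeff.
by apply: nondecreasing_series => n _ _; exact: exp_coeff_ge0.
Qed.

(** With [x = 2 y], the difference of the two sides is the square of
    [exp y - exp (- y)] minus [(2 y)^2], and [1 - y + y^2 / 2] bounds the inverse
    of [1 + y + y^2 / 2], since their product is [1 + y^4 / 4]. *)
Lemma expR_cosh_ge x : 0 <= x -> 2 + x ^+ 2 <= expR x + expR (- x).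
Proof.
move=> x0; set y := x / 2; have y0 : 0 <= y by rewrite divr_ge0.
have -> : x = y + y by rewrite /y; field.
set e := expR y; have e0 : 0 < e by exact: expR_gt0.
have eE : 1 + y + y ^+ 2 / 2 <= e by exact: expR_ge_quadratic.
rewrite opprD !expRD expRN -/e.
have sinh : 2 * y <= e - e^-1.
  have P0 : 0 < 1 + y + y ^+ 2 / 2 by nra.
  have e1 : e^-1 <= (1 + y + y ^+ 2 / 2)^-1 by rewrite lef_pV2 ?posrE.
  have P1 : (1 + y + y ^+ 2 / 2)^-1 <= 1 - y + y ^+ 2 / 2.
    rewrite -[leLHS]mul1r ler_pdivrMr// -subr_ge0.
    have -> : (1 - y + y ^+ 2 / 2) * (1 + y + y ^+ 2 / 2) - 1 =
      (y ^+ 2) ^+ 2 / 4 by field.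
    by rewrite divr_ge0 ?sqr_ge0.
  lra.
have -> : e * e + e^-1 * e^-1 = 2 + (e - e^-1) ^+ 2 by field; rewrite gt_eqF.
rewrite lerD2l; have -> : (y + y) ^+ 2 = (2 * y) ^+ 2 by ring.
by rewrite lerXn2r ?nnegrE//; nra.
Qed.

(** This bound and the next one are second-order expansions at 0, and the error
    terms are chosen so that, after squaring, the claim becomes the positivity
    of a polynomial divisible by [t^3]. *)
Lemma invsqrt_1B_le t : 0 < t <= 2^-1 ->
  (Num.sqrt (1 - t))^-1 <= 1 + t / 2 + 3 / 8 * t ^+ 2 + t ^+ 3.
Proof.
move=> /andP[t0 t1]; set h := Num.sqrt (1 - t).
have h0 : 0 < h by rewrite sqrtr_gt0; lra.
have h2 : h ^+ 2 = 1 - t by rewrite sqr_sqrtr//; lra.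
set P := 1 + _ + _ + _.
have P0 : 0 <= P by rewrite /P !addr_ge0// ?mulr_ge0 ?exprn_ge0 ?ltW.
rewrite -[leLHS]mul1r ler_pdivrMr//.
have hP0 : 0 <= P * h by rewrite mulr_ge0// ltW.
rewrite -(@ler_pXn2r _ 2) ?nnegrE// expr1n exprMn h2 -subr_ge0 /P.
have -> : (1 + t / 2 + 3 / 8 * t ^+ 2 + t ^+ 3) ^+ 2 * (1 - t) - 1 =
  t ^+ 3 * (11 / 8 - 79 / 64 * t - 25 / 64 * t ^+ 2 + t ^+ 3 / 4 - t ^+ 4).
  by field.
rewrite mulr_ge0 ?exprn_ge0//; first exact: ltW.
have t2 : t ^+ 2 <= t / 2 by nra.
have t3 : 0 <= t ^+ 3 by rewrite exprn_ge0// ltW.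
have t4 : t ^+ 4 <= t / 8.
  have -> : t ^+ 4 = t ^+ 2 * t ^+ 2 by ring.
  by have := sqr_ge0 t; nra.
by nra.
Qed.

Lemma invsqrt_1D_le t : 0 < t <= 2^-1 ->
  (Num.sqrt (1 + t))^-1 <= 1 - t / 2 + 3 / 8 * t ^+ 2.
Proof.
move=> /andP[t0 t1]; set h := Num.sqrt (1 + t).
have h0 : 0 < h by rewrite sqrtr_gt0; lra.
have h2 : h ^+ 2 = 1 + t by rewrite sqr_sqrtr//; lra.
set P := 1 - _ + _.
have P0 : 0 <= P by rewrite /P; nra.
rewrite -[leLHS]mul1r ler_pdivrMr//.
have hP0 : 0 <= P * h by rewrite mulr_ge0// ltW.
rewrite -(@ler_pXn2r _ 2) ?nnegrE// expr1n exprMn h2 -subr_ge0 /P.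
have -> : (1 - t / 2 + 3 / 8 * t ^+ 2) ^+ 2 * (1 + t) - 1 =
  t ^+ 3 * (5 / 8 - 15 / 64 * t + 9 / 64 * t ^+ 2) by field.
rewrite mulr_ge0 ?exprn_ge0//; first exact: ltW.
by nra.
Qed.

End exponential_inequalities.

Section gaussian_moments.
Variables (R : realType) (m v : R).
Hypothesis v_gt0 : 0 < v.
Local Notation mu := (@lebesgue_measure R).
Local Notation f := (normal_pdf m (Num.sqrt v)).

Let s0 : Num.sqrt v != 0. Proof. by rewrite gt_eqF// sqrtr_gt0. Qed.

Lemma normal_pdf_sqrtE x : f x =
  (Num.sqrt (2 * pi * v))^-1 * expR (- ((x - m) ^+ 2 / v / 2)).
Proof.
rewrite normal_pdfE//= /normal_peak /normal_fun sqr_sqrtr ?ltW//.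
congr (_^-1 * expR _); first by congr Num.sqrt; ring.
by field; rewrite gt_eqF.
Qed.

(** A Gaussian density tilted by the exponential of a quadratic is again
    Gaussian.  Its known total mass gives all the exponential moments of
    [z = (x - m)^2 / (2 v)], from which the polynomial moments are read off as
    [t] tends to 0. *)
Lemma normal_pdf_tilt t x : t < 1 ->
  f x * expR (t * ((x - m) ^+ 2 / v / 2)) =
  (Num.sqrt (1 - t))^-1 * normal_pdf m (Num.sqrt (v / (1 - t))) x.
Proof.
move=> t1; have t1' : 0 < 1 - t by rewrite subr_gt0.
have vt : 0 < v / (1 - t) by rewrite divr_gt0.
have sn : Num.sqrt (v / (1 - t)) != 0 by rewrite gt_eqF// sqrtr_gt0.
rewrite normal_pdf_sqrtE normal_pdfE//= /normal_peak /normal_fun.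
rewrite (sqr_sqrtr (ltW vt)) -[LHS]mulrA -expRD [RHS]mulrA; congr (_ * expR _).
  rewrite -invfM -sqrtrM ?ltW//; congr (Num.sqrt _)^-1.
  by rewrite -mulr_natr; field; rewrite gt_eqF.
by rewrite -mulr_natr; field; rewrite !gt_eqF.
Qed.

Lemma measurable_normal_pdfM (g : R -> R) : measurable_fun setT g ->
  measurable_fun setT (fun x => (f x * g x)%:E).
Proof.
move=> mg; apply/measurable_EFinP; apply: measurable_funM => //.
exact: measurable_normal_pdf.
Qed.

Let mz : measurable_fun setT (fun x : R => (x - m) ^+ 2 / v / 2).
Proof.
apply: measurable_funM => //; apply: measurable_funM => //.
by apply: measurable_funX; exact: measurable_funB.
Qed.

Let integral_tilt t : t < 1 ->
  (\int[mu]_x (f x * expR (t * ((x - m) ^+ 2 / v / 2)))%:E =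
   (Num.sqrt (1 - t))^-1%:E)%E.
Proof.
move=> t1; under eq_integral do rewrite normal_pdf_tilt// EFinM.
rewrite ge0_integralZl_EFin//.
- by rewrite integral_normal_pdf mule1.
- by move=> x _; rewrite lee_fin normal_pdf_ge0.
- by apply/measurable_EFinP; exact: measurable_normal_pdf.
Qed.

Let z x : R := (x - m) ^+ 2 / v / 2.
Let z_ge0 x : 0 <= z x.
Proof. by rewrite /z !divr_ge0 ?sqr_ge0// ltW. Qed.

Let mexp t : measurable_fun setT (fun x : R => expR (t * z x)).
Proof. by apply: measurableT_comp => //; exact: measurable_funM. Qed.

Let integral_pdfM_ge0 (g : R -> R) : (forall x, 0 <= g x) ->
  (0 <= \int[mu]_x (f x * g x)%:E)%E.
Proof.
move=> g0; apply: integral_ge0 => x _.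
by rewrite lee_fin mulr_ge0 ?normal_pdf_ge0.
Qed.

Let integral_affine (c k : R) (g : R -> R) : 0 <= c -> 0 <= k ->
  measurable_fun setT g -> (forall x, 0 <= g x) ->
  (\int[mu]_x (f x * (c + k * g x))%:E =
   c%:E + k%:E * \int[mu]_x (f x * g x)%:E)%E.
Proof.
move=> c0 k0 mg g0.
have fg0 x : (0 <= (f x * g x)%:E)%E by rewrite lee_fin mulr_ge0 ?normal_pdf_ge0.
under eq_integral => x _.
  rewrite (_ : (f x * (c + k * g x))%:E =
    c%:E * (f x)%:E + k%:E * (f x * g x)%:E)%E; first over.
  by rewrite -!EFinM -EFinD; congr EFin; ring.
have mf : measurable_fun setT (fun x => (f x)%:E).
  by apply/measurable_EFinP; exact: measurable_normal_pdf.
have mfg := measurable_normal_pdfM mg.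
rewrite ge0_integralD//; last 4 first.
- by move=> x _; rewrite mule_ge0// lee_fin normal_pdf_ge0.
- exact: measurable_funeM.
- by move=> x _; rewrite mule_ge0.
- exact: measurable_funeM.
rewrite !ge0_integralZl_EFin//; last by move=> x _; rewrite lee_fin normal_pdf_ge0.
by rewrite integral_normal_pdf mule1.
Qed.

Let le_of_perturbed (M : \bar R) (c k : R) :
  (forall t : R, 0 < t <= 2^-1 -> (M <= (c + k * t)%:E)%E) -> 0 < k -> (M <= c%:E)%E.
Proof.
move=> h k0; apply/lee_addgt0Pr => e e0.
pose t := Num.min 2^-1 (e / k).
have t0 : 0 < t by rewrite /t lt_min invr_gt0 ltr0n/= divr_gt0.
have te : t <= e / k by rewrite ge_min lexx orbT.
apply: le_trans (h t _) _; first by rewrite t0 ge_min lexx.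
by rewrite -EFinD lee_fin lerD2l -ler_pdivlMl// mulrC.
Qed.

(** [exp (t z) >= 1 + t z], whence [t E z <= (1 - t)^(-1/2) - 1]. *)
Lemma normal_second_moment_le :
  (\int[mu]_x (f x * (x - m) ^+ 2)%:E <= v%:E)%E.
Proof.
suff : (\int[mu]_x (f x * z x)%:E <= (2^-1)%:E)%E.
  have -> : (fun x => (f x * (x - m) ^+ 2)%:E) =
      (fun x => (2 * v)%:E * (f x * z x)%:E)%E.
    by apply/funext => x; rewrite -EFinM /z; congr EFin; field; rewrite gt_eqF.
  rewrite ge0_integralZl_EFin//; last 3 first.
  - by move=> x _; rewrite lee_fin mulr_ge0 ?normal_pdf_ge0.
  - exact: measurable_normal_pdfM.
  - by rewrite mulr_ge0// ltW.
  move=> h; apply: le_trans (lee_wpmul2l _ h) _.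
    by rewrite lee_fin mulr_ge0// ltW.
  by rewrite -EFinM lee_fin le_eqVlt; apply/orP; left; apply/eqP; field.
apply: (@le_of_perturbed _ _ 1) => // t /[dup] tle /andP[t0 t1].
have t1' : t < 1 by lra.
have : (\int[mu]_x (f x * (1 + t * z x))%:E <= (Num.sqrt (1 - t))^-1%:E)%E.
  rewrite -(integral_tilt t1'); apply: ge0_le_integral_nonmeas => x.
    by rewrite lee_fin mulr_ge0 ?normal_pdf_ge0// addr_ge0// mulr_ge0// ltW.
  by rewrite lee_fin ler_wpM2l ?normal_pdf_ge0// expR_ge1Dx.
rewrite (integral_affine ler01 (ltW t0) mz z_ge0) => h.
have := integral_pdfM_ge0 z_ge0; move: h.
case: (\int[mu]_x _)%E => [M| |]//.
  rewrite -EFinM -EFinD !lee_fin => h _.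
  have := invsqrt_1B_le tle; nra.
by rewrite gt0_muley ?lte_fin// addey// leye_eq.
Qed.

(** [exp (t z) + exp (- t z) >= 2 + t^2 z^2], and the terms of order [t] cancel in
    [(1 - t)^(-1/2) + (1 + t)^(-1/2)]. *)
Lemma normal_fourth_moment_le :
  (\int[mu]_x (f x * (x - m) ^+ 4)%:E <= (3 * v ^+ 2)%:E)%E.
Proof.
have mz2 : measurable_fun setT (fun x => z x ^+ 2) by exact: measurable_funX.
suff : (\int[mu]_x (f x * z x ^+ 2)%:E <= (3 / 4)%:E)%E.
  have -> : (fun x => (f x * (x - m) ^+ 4)%:E) =
      (fun x => (4 * v ^+ 2)%:E * (f x * z x ^+ 2)%:E)%E.
    by apply/funext => x; rewrite -EFinM /z; congr EFin; field; rewrite gt_eqF.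
  rewrite ge0_integralZl_EFin//; last 3 first.
  - by move=> x _; rewrite lee_fin mulr_ge0 ?normal_pdf_ge0// sqr_ge0.
  - exact: measurable_normal_pdfM.
  - by rewrite mulr_ge0// sqr_ge0.
  move=> h; apply: le_trans (lee_wpmul2l _ h) _.
    by rewrite lee_fin mulr_ge0// sqr_ge0.
  by rewrite -EFinM lee_fin le_eqVlt; apply/orP; left; apply/eqP; field.
apply: (@le_of_perturbed _ _ 1) => // t /[dup] tle /andP[t0 t1].
have t1' : t < 1 by lra.
have t1n : - t < 1 by lra.
have : (\int[mu]_x (f x * (2 + t ^+ 2 * z x ^+ 2))%:E <=
    (Num.sqrt (1 - t))^-1%:E + (Num.sqrt (1 + t))^-1%:E)%E.
  rewrite -[in X in (_ + X)%E](opprK t) -(integral_tilt t1') -(integral_tilt t1n).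
  rewrite -ge0_integralD//; last 4 first.
  - by move=> x _; rewrite lee_fin mulr_ge0 ?normal_pdf_ge0// expR_ge0.
  - exact: measurable_normal_pdfM.
  - by move=> x _; rewrite lee_fin mulr_ge0 ?normal_pdf_ge0// expR_ge0.
  - exact: measurable_normal_pdfM.
  apply: ge0_le_integral_nonmeas => x.
    rewrite lee_fin mulr_ge0 ?normal_pdf_ge0// addr_ge0//.
    by rewrite mulr_ge0// sqr_ge0.
  rewrite -EFinD lee_fin -mulrDr ler_wpM2l ?normal_pdf_ge0//.
  rewrite -exprMn mulNr; apply: expR_cosh_ge.
  by rewrite mulr_ge0// ltW.
rewrite (@integral_affine 2 (t ^+ 2) (fun x => z x ^+ 2)) ?sqr_ge0//; last first.
  by move=> x; exact: sqr_ge0.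
move=> h.
have := @integral_pdfM_ge0 (fun x => z x ^+ 2) (fun x => sqr_ge0 _); move: h.
case: (\int[mu]_x _)%E => [M| |]//.
  rewrite -EFinM -!EFinD !lee_fin => h _.
  have lB := invsqrt_1B_le tle; have lD := invsqrt_1D_le tle.
  have : t ^+ 2 * M <= t ^+ 2 * (3 / 4 + t).
    have -> : t ^+ 2 * (3 / 4 + t) = 3 / 4 * t ^+ 2 + t ^+ 3 by ring.
    by lra.
  by rewrite ler_pM2l ?exprn_gt0// mul1r.
by rewrite gt0_muley ?lte_fin ?exprn_gt0// addey// leye_eq.
Qed.

Lemma normal_affine_second_moment_le (a c : R) :
  (\int[mu]_x (f x * (a * (x - m) + c) ^+ 2)%:E <=
   (2 * (a ^+ 2 * v + c ^+ 2))%:E)%E.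
Proof.
have m2 : measurable_fun setT (fun x : R => (x - m) ^+ 2).
  by apply: measurable_funX; exact: measurable_funB.
have c2 : 0 <= 2 * c ^+ 2 by rewrite mulr_ge0// sqr_ge0.
have a2 : 0 <= 2 * a ^+ 2 by rewrite mulr_ge0// sqr_ge0.
apply: (@le_trans _ _ (\int[mu]_x
    (f x * (2 * c ^+ 2 + 2 * a ^+ 2 * (x - m) ^+ 2))%:E)%E).
  apply: ge0_le_integral_nonmeas => x.
    by rewrite lee_fin mulr_ge0 ?normal_pdf_ge0// sqr_ge0.
  rewrite lee_fin ler_wpM2l ?normal_pdf_ge0// -subr_ge0.
  have -> : 2 * c ^+ 2 + 2 * a ^+ 2 * (x - m) ^+ 2 - (a * (x - m) + c) ^+ 2 =
    (a * (x - m) - c) ^+ 2 by ring.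
  exact: sqr_ge0.
rewrite (integral_affine c2 a2 m2); last by move=> x; exact: sqr_ge0.
apply: (@le_trans _ _ ((2 * c ^+ 2)%:E + (2 * a ^+ 2)%:E * v%:E)%E).
  by rewrite leeD2l// lee_wpmul2l ?normal_second_moment_le// lee_fin.
by rewrite -EFinM -EFinD lee_fin le_eqVlt; apply/orP; left; apply/eqP; ring.
Qed.

(** Averaging the integral with its image under the reflection of the line
    about [m] cancels the odd moments. *)
Lemma normal_affine_fourth_moment_le (a c : R) :
  (\int[mu]_x (f x * (a * (x - m) + c) ^+ 4)%:E <=
   (3 * a ^+ 4 * v ^+ 2 + 6 * a ^+ 2 * v * c ^+ 2 + c ^+ 4)%:E)%E.
Proof.
have m1 : measurable_fun setT (fun x : R => x - m) by exact: measurable_funB.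
have mX k : measurable_fun setT (fun x : R => (x - m) ^+ k).
  exact: measurable_funX.
have sqr4 (x : R) : 0 <= x ^+ 4 by rewrite (exprM x 2 2) sqr_ge0.
have A2 : 0 <= 12 * a ^+ 2 * c ^+ 2.
  by rewrite mulr_ge0 ?sqr_ge0// mulr_ge0// sqr_ge0.
have A0 : 0 <= 2 * c ^+ 4 by rewrite mulr_ge0.
have A4 : 0 <= 2 * a ^+ 4 by rewrite mulr_ge0.
pose F x := (f x * (a * (x - m) + c) ^+ 4)%:E.
have mF : measurable_fun setT F.
  apply: measurable_normal_pdfM; apply: measurable_funX.
  by apply: measurable_funD => //; exact: measurable_funM.
have F0 x : (0 <= F x)%E by rewrite lee_fin mulr_ge0 ?normal_pdf_ge0.
have mF' : measurable_fun setT (fun x : R => F (2 * m - x)).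
  apply: measurableT_comp => //.
  exact: (measurable_funB (measurable_cst _) (@measurable_id _ _ setT)).
have half : (\int[mu]_x F x + \int[mu]_x F x <=
    (2 * (3 * a ^+ 4 * v ^+ 2 + 6 * a ^+ 2 * v * c ^+ 2 + c ^+ 4))%:E)%E.
  rewrite -[X in (X + _)%E](ge0_integral_refl (2 * m) mF F0).
  rewrite -ge0_integralD//.
  have fE x : f (2 * m - x) = f x.
    by rewrite !normal_pdf_sqrtE; congr (_ * expR _); field; rewrite gt_eqF.
  have FE x : (F (2 * m - x)%R + F x)%E = (f x * (2 * c ^+ 4 +
      1 * (12 * a ^+ 2 * c ^+ 2 * (x - m) ^+ 2 + 2 * a ^+ 4 * (x - m) ^+ 4)))%:E.
    by rewrite /F fE -EFinD; congr EFin; ring.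
  under eq_integral do rewrite FE.
  rewrite (@integral_affine _ _ (fun x => 12 * a ^+ 2 * c ^+ 2 * (x - m) ^+ 2 +
    2 * a ^+ 4 * (x - m) ^+ 4) A0 ler01); last 2 first.
  - by apply: measurable_funD; exact: measurable_funM.
  - by move=> x; apply: addr_ge0; apply: mulr_ge0 => //; exact: sqr_ge0.
  rewrite mul1e.
  have E2 : (\int[mu]_x (f x * (0 + 12 * a ^+ 2 * c ^+ 2 * (x - m) ^+ 2))%:E <=
      (12 * a ^+ 2 * c ^+ 2 * v)%:E)%E.
    rewrite (integral_affine (lexx 0) A2 (mX 2%N)); last first.
      by move=> x; exact: sqr_ge0.
    by rewrite add0e [leRHS]EFinM lee_wpmul2l ?normal_second_moment_le// lee_fin.
  have E4 : (\int[mu]_x (f x * (0 + 2 * a ^+ 4 * (x - m) ^+ 4))%:E <=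
      (2 * a ^+ 4 * (3 * v ^+ 2))%:E)%E.
    rewrite (integral_affine (lexx 0) A4 (mX 4%N)) => [|x]; last exact: sqr4.
    by rewrite add0e [leRHS]EFinM lee_wpmul2l ?normal_fourth_moment_le// lee_fin.
  apply: (@le_trans _ _ ((2 * c ^+ 4)%:E + ((12 * a ^+ 2 * c ^+ 2 * v)%:E +
      (2 * a ^+ 4 * (3 * v ^+ 2))%:E))%E); last first.
    by rewrite -!EFinD lee_fin le_eqVlt; apply/orP; left; apply/eqP; ring.
  rewrite leeD2l//; apply: le_trans (leeD E2 E4).
  rewrite -ge0_integralD//; last 4 first.
  - move=> x _; rewrite lee_fin add0r mulr_ge0 ?normal_pdf_ge0//.
    by rewrite mulr_ge0// sqr_ge0.
  - apply: measurable_normal_pdfM; under eq_fun do rewrite add0r.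
    exact: measurable_funM.
  - move=> x _; rewrite lee_fin add0r mulr_ge0 ?normal_pdf_ge0//.
    by rewrite mulr_ge0.
  - apply: measurable_normal_pdfM; under eq_fun do rewrite add0r.
    exact: measurable_funM.
  apply: ge0_le_integral_nonmeas => x.
    rewrite lee_fin mulr_ge0 ?normal_pdf_ge0// addr_ge0//.
      by rewrite mulr_ge0// sqr_ge0.
    by rewrite mulr_ge0.
  by rewrite -EFinD -mulrDr !add0r.
have : (0 <= \int[mu]_x F x)%E by exact: integral_ge0.
move: half; case: (\int[mu]_x F x)%E => [M| |]//.
  by rewrite -EFinD !lee_fin => + _; lra.
Qed.

End gaussian_moments.

(** * Gaussian measures with diagonal covariance *)

Section product_integral.
Variable R : realType.

Lemma measurable_rV_prod n (f : 'I_n -> R -> R) :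
  (forall j, measurable_fun setT (f j)) ->
  measurable_fun setT (fun x : 'rV[R]_n => \prod_(j < n) f j (x ord0 j)).
Proof.
move=> mf; apply: measurable_prod => j _.
exact: (measurableT_comp (mf j) (measurable_rV_coord j)).
Qed.

Lemma integral_rV_prod n (f : 'I_n -> R -> R) :
  (forall j, measurable_fun setT (f j)) -> (forall j x, 0 <= f j x) ->
  (\int[lebesgue_rV R n]_x (\prod_(j < n) f j (x ord0 j))%:E =
   \prod_(j < n) \int[lebesgue_measure]_y (f j y)%:E)%E.
Proof.
elim: n f => [|n IHn] f mf f0.
  rewrite big_ord0 integral_dirac//= ?diracE ?mem_set ?mul1e//.
    by rewrite big_ord0.
  by under eq_fun do rewrite big_ord0; exact: measurable_cst.
have mF := measurable_rV_prod mf.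
have F0 m (g : 'I_m -> R -> R) (x : 'rV[R]_m) : (forall j x, 0 <= g j x) ->
    (0 <= (\prod_(j < m) g j (x ord0 j))%:E)%E.
  by move=> g0; rewrite lee_fin prodr_ge0.
pose g j := f (lift ord0 j).
have mg : forall j, measurable_fun setT (g j) by move=> j; exact: mf.
have mG := measurable_rV_prod mg.
have mcons : measurable_fun [set: measurableTypeR R * 'rV[R]_n] (@rV_cons R n).
  exact: measurable_rV_cons.
rewrite [LHS](ge0_integral_pushforward mcons
  (lebesgue_measure \x lebesgue_rV R n)%E measurableT); last 2 first.
- exact/measurable_EFinP.
- by move=> x _; exact: F0.
rewrite preimage_setT fubini_tonelli1; last 2 first.
- by apply/measurable_EFinP; exact: measurableT_comp mF mcons.
- by move=> x; exact: (F0 _ f _ f0).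
rewrite /fubini_F big_ord_recl -IHn//.
transitivity (\int[lebesgue_measure]_y ((f ord0 y)%:E *
   \int[lebesgue_rV R n]_x (\prod_(j < n) g j (x ord0 j))%:E))%E.
  apply: eq_integral => y _.
  rewrite -ge0_integralZl_EFin//; last 2 first.
  - by move=> x _; apply: F0 => j z; exact: f0.
  - exact/measurable_EFinP.
  apply: eq_integral => x _.
  rewrite -EFinM.
  transitivity (\prod_(j < n.+1) f j (rV_cons (y, x) ord0 j))%:E => //.
  rewrite big_ord_recl rV_cons0; congr (_ * _)%:E.
  by apply: eq_bigr => j _; rewrite rV_consS.
rewrite ge0_integralZr//.
- by apply/measurable_EFinP; exact: (mf ord0).
- by move=> y _; rewrite lee_fin.
- by apply: integral_ge0 => x _; apply: F0 => j z; exact: f0.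
Qed.

End product_integral.

Section diagonal_gaussian.
Variables (R : realType) (I : choiceType) (d : nat) (m v : I -> nat -> R).
Hypothesis v_gt0 : forall i j, 0 < v i j.
Implicit Types (i : I) (x : 'rV[R]_d).

Local Notation phi i := (@mix_comp R I d m v i).
Local Notation pdf i j := (normal_pdf (m i j) (Num.sqrt (v i j))).
Local Notation leb := (lebesgue_rV R d).

Lemma invmx_mix_cov i :
  invmx (mix_cov d v i) = diag_mx (\row_j (v i j)^-1).
Proof.
have AB : mix_cov d v i *m diag_mx (\row_j (v i j)^-1) = 1%:M.
  rewrite /mix_cov mulmx_diag -diag_const_mx; congr diag_mx.
  by apply/rowP => j; rewrite !mxE mulfV// gt_eqF.
have [uA _] := mulmx1_unit AB.
by rewrite -[RHS](mulKmx uA) AB mulmx1.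
Qed.

Lemma mix_score_coordE i x j :
  mix_score m v i x ord0 j = - ((x ord0 j - m i j) / v i j).
Proof.
by rewrite /mix_score invmx_mix_cov mxE mul_mx_diag !mxE.
Qed.

Lemma mix_compE i x : phi i x = \prod_(j < d) pdf i j (x ord0 j).
Proof.
rewrite /mix_comp /gauss_pdf invmx_mix_cov mul_mx_diag mxE det_diag.
under [RHS]eq_bigr do rewrite normal_pdf_sqrtE//.
rewrite big_split/= mulrC; congr (_ * _).
  rewrite prodfV; congr (_^-1).
  have -> : (2 * pi) ^+ d * \prod_(j < d) (\row_j v i j) ord0 j =
      \prod_(j < d) (2 * pi * v i j).
    rewrite big_split/= prodr_const card_ord; congr (_ * _).
    by apply: eq_bigr => j _; rewrite mxE.
  elim/big_rec2 : _ => [|j x1 x2 _ <-]; first by rewrite sqrtr1.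
  by rewrite sqrtrM// !mulr_ge0 ?pi_ge0// ltW.
rewrite -expR_sum; congr expR; rewrite sumrN mulNr; congr (- _).
rewrite big_distrl/=; apply: eq_bigr => j _.
by rewrite !mxE expr2; congr (_ / _); rewrite mulrAC.
Qed.

Lemma mix_comp_gt0 i x : 0 < phi i x.
Proof.
rewrite mix_compE; apply: prodr_gt0 => j _.
rewrite normal_pdf_sqrtE// mulr_gt0 ?expR_gt0// invr_gt0 sqrtr_gt0.
by rewrite !mulr_gt0 ?pi_gt0.
Qed.

Lemma mix_comp_ge0 i x : 0 <= phi i x. Proof. exact/ltW/mix_comp_gt0. Qed.

Lemma measurable_mix_comp i : measurable_fun setT (phi i).
Proof.
rewrite (_ : phi i = fun x => \prod_(j < d) pdf i j (x ord0 j)); last first.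
  by apply/funext => x; rewrite mix_compE.
apply: (@measurable_rV_prod _ _ (fun j => pdf i j)) => j.
exact: measurable_normal_pdf.
Qed.

Lemma measurable_coord j : measurable_fun setT (fun x : 'rV[R]_d => x ord0 j).
Proof. exact: (@measurable_rV_coord R d j). Qed.

(** The other coordinates integrate to 1. *)
Lemma integral_mix_comp_coord i j (g : R -> R) : measurable_fun setT g ->
  (forall y, 0 <= g y) ->
  (\int[leb]_x (phi i x * g (x ord0 j))%:E =
   \int[lebesgue_measure]_y (pdf i j y * g y)%:E)%E.
Proof.
move=> mg g0.
pose f (k : 'I_d) y := if k == j then pdf i k y * g y else pdf i k y.
have mf k : measurable_fun setT (f k).
  rewrite /f; case: eqP => _; last exact: measurable_normal_pdf.
  by apply: measurable_funM => //; exact: measurable_normal_pdf.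
have f0 k y : 0 <= f k y.
  by rewrite /f; case: eqP => _; rewrite ?mulr_ge0 ?normal_pdf_ge0.
transitivity (\int[leb]_x (\prod_(k < d) f k (x ord0 k))%:E)%E.
  apply: eq_integral => x _; congr EFin.
  rewrite mix_compE (bigD1 j)//= [in RHS](bigD1 j)//= {1}/f eqxx mulrAC.
  congr (_ * _); apply: eq_bigr => k kj.
  by rewrite /f (negbTE kj).
rewrite integral_rV_prod// (bigD1 j)//= big1 ?mule1.
  by apply: eq_integral => y _; rewrite /f eqxx.
move=> k kj; under eq_integral do rewrite /f (negbTE kj).
exact: integral_normal_pdf.
Qed.

Lemma integral_mix_comp i : (\int[leb]_x (phi i x)%:E = 1)%E.
Proof.
transitivity (\int[leb]_x (\prod_(j < d) pdf i j (x ord0 j))%:E)%E.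
  by apply: eq_integral => x _; rewrite mix_compE.
rewrite (@integral_rV_prod _ _ (fun j => pdf i j)) => [|j|j y]; last 2 first.
- exact: measurable_normal_pdf.
- exact: normal_pdf_ge0.
by rewrite big1// => j _; exact: integral_normal_pdf.
Qed.

Section affine_moments.
Variables (i : I) (a c g : 'I_d -> R).
Hypothesis g_ge0 : forall j, 0 <= g j.

Let z j (x : 'rV[R]_d) := a j * (x ord0 j - m i j) + c j.

Let maff j : measurable_fun setT (fun y : R => a j * (y - m i j) + c j).
Proof.
apply: measurable_funD => //; apply: measurable_funM => //.
exact: measurable_funB.
Qed.

Let mphiX j k n : measurable_fun setT (fun x => (phi i x * (k * z j x ^+ n))%:E).
Proof.
apply/measurable_EFinP; apply: measurable_funM; first exact: measurable_mix_comp.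
apply: measurable_funM => //; apply: measurable_funX.
exact: (measurableT_comp (maff j) (measurable_coord j)).
Qed.

Let ge0_pow4 (y : R) : 0 <= y ^+ 4. Proof. by rewrite (exprM y 2 2) sqr_ge0. Qed.

(** The factor 2 pays for bounding [(a y + c)^2] by [2 a^2 y^2 + 2 c^2]. *)
Lemma integral_mix_comp_sqnorm_le :
  (\int[leb]_x (phi i x *
     \sum_(j < d) g j * (a j * (x ord0 j - m i j) + c j) ^+ 2)%:E <=
   (2 * \sum_(j < d) g j * (a j ^+ 2 * v i j + c j ^+ 2))%:E)%E.
Proof.
change (\int[leb]_x (phi i x * \sum_(j < d) g j * z j x ^+ 2)%:E <=
  (2 * \sum_(j < d) g j * (a j ^+ 2 * v i j + c j ^+ 2))%:E)%E.
under eq_integral => x _ do rewrite mulr_sumr -sumEFin.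
rewrite ge0_integral_sum//; last first.
  by move=> j x _; rewrite lee_fin mulr_ge0 ?mix_comp_ge0// mulr_ge0 ?sqr_ge0.
rewrite mulr_sumr -sumEFin; apply: lee_sum => j _.
have -> : (fun x => (phi i x * (g j * z j x ^+ 2))%:E) =
    (fun x => (g j)%:E * (phi i x * z j x ^+ 2)%:E)%E.
  by apply/funext => x; rewrite -EFinM mulrCA.
rewrite ge0_integralZl_EFin//; last 2 first.
- by move=> x _; rewrite lee_fin mulr_ge0 ?mix_comp_ge0 ?sqr_ge0.
- by have := mphiX j 1 2; under eq_fun do rewrite mul1r.
rewrite mulrCA EFinM lee_wpmul2l ?lee_fin//.
rewrite (@integral_mix_comp_coord _ _ (fun y => (a j * (y - m i j) + c j) ^+ 2)).
- exact: normal_affine_second_moment_le.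
- exact: measurable_funX.
- by move=> y; exact: sqr_ge0.
Qed.

Let H j := Num.sqrt (3 * a j ^+ 4 * v i j ^+ 2 +
  6 * a j ^+ 2 * v i j * c j ^+ 2 + c j ^+ 4).

Let integral_fourth_le j :
  (\int[leb]_x (phi i x * z j x ^+ 4)%:E <= (H j ^+ 2)%:E)%E.
Proof.
rewrite (@integral_mix_comp_coord _ _ (fun y => (a j * (y - m i j) + c j) ^+ 4)).
- rewrite sqr_sqrtr; first exact: normal_affine_fourth_moment_le.
  have a2 := sqr_ge0 (a j); have c2 := sqr_ge0 (c j).
  have a4 := ge0_pow4 (a j); have c4 := ge0_pow4 (c j).
  have v2 := sqr_ge0 (v i j); have v0 := ltW (v_gt0 i j).
  by rewrite !addr_ge0// mulr_ge0// mulr_ge0// mulr_ge0.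
- exact: measurable_funX.
- by move=> y; exact: ge0_pow4.
Qed.

Let integral_cross_le j k :
  (\int[leb]_x (phi i x * (z j x ^+ 2 * z k x ^+ 2))%:E <= (H j * H k)%:E)%E.
Proof.
have mz4 l : measurable_fun setT (fun x => (phi i x * z l x ^+ 4)%:E).
  by have := mphiX l 1 4; under eq_fun do rewrite mul1r.
have z40 l x : (0 <= (phi i x * z l x ^+ 4)%:E)%E.
  by rewrite lee_fin mulr_ge0 ?mix_comp_ge0.
have rootE l x : ((phi i x * z l x ^+ 4)%:E `^ 2^-1 =
    (Num.sqrt (phi i x) * z l x ^+ 2)%:E)%E.
  have p0 : 0 <= phi i x * z l x ^+ 4 by have := z40 l x; rewrite lee_fin.
  rewrite poweR_EFin (powR12_sqrt p0) sqrtrM ?mix_comp_ge0//.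
  by rewrite (exprM _ 2 2) sqrtr_sqr ger0_norm// sqr_ge0.
have -> : (fun x => (phi i x * (z j x ^+ 2 * z k x ^+ 2))%:E) =
    (fun x => (phi i x * z j x ^+ 4)%:E `^ 2^-1 *
              (phi i x * z k x ^+ 4)%:E `^ 2^-1)%E.
  apply/funext => x; rewrite !rootE -EFinM; congr EFin.
  by rewrite [RHS]mulrACA -[X in _ = X * _]expr2 sqr_sqrtr// mix_comp_ge0.
apply: le_trans (integral_cauchy_schwarz _ (mz4 j) (mz4 k) (z40 j) (z40 k)) _.
have H0 l : 0 <= H l by exact: sqrtr_ge0.
have rootH l : ((\int[leb]_x (phi i x * z l x ^+ 4)%:E) `^ 2^-1 <= (H l)%:E)%E.
  have -> : ((H l)%:E = (H l ^+ 2)%:E `^ 2^-1)%E.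
    by rewrite poweR_EFin powR12_sqrt ?sqr_ge0// sqrtr_sqr ger0_norm.
  apply: gt0_ler_poweR; rewrite ?invr_ge0 ?in_itv//= ?leey ?andbT//.
  - exact: integral_ge0.
  - by rewrite lee_fin sqr_ge0.
by rewrite EFinM lee_pmul ?poweR_ge0.
Qed.

(** Expanding the square leaves mixed moments of two coordinates, which
    Cauchy-Schwarz reduces to fourth moments of one coordinate: this is
    Minkowski's inequality in the square-integrable functions. *)
Lemma integral_mix_comp_sqnorm2_le :
  (\int[leb]_x (phi i x *
     (\sum_(j < d) g j * (a j * (x ord0 j - m i j) + c j) ^+ 2) ^+ 2)%:E <=
   ((\sum_(j < d) g j * Num.sqrt (3 * a j ^+ 4 * v i j ^+ 2 +
      6 * a j ^+ 2 * v i j * c j ^+ 2 + c j ^+ 4)) ^+ 2)%:E)%E.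
Proof.
change (\int[leb]_x (phi i x * (\sum_(j < d) g j * z j x ^+ 2) ^+ 2)%:E <=
  ((\sum_(j < d) g j * H j) ^+ 2)%:E)%E.
have mzz j k : measurable_fun setT
    (fun x => (phi i x * (z j x ^+ 2 * z k x ^+ 2))%:E).
  apply/measurable_EFinP; apply: measurable_funM.
    exact: measurable_mix_comp.
  by apply: measurable_funM; apply: measurable_funX;
    exact: (measurableT_comp (maff _) (measurable_coord _)).
have zz0 j k x : (0 <= (phi i x * (z j x ^+ 2 * z k x ^+ 2))%:E)%E.
  by rewrite lee_fin mulr_ge0 ?mix_comp_ge0// mulr_ge0 ?sqr_ge0.
have gg0 j k : 0 <= g j * g k by rewrite mulr_ge0.
have expand x : (phi i x * (\sum_(j < d) g j * z j x ^+ 2) ^+ 2)%:E =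
    (\sum_(p : 'I_d * 'I_d) (g p.1 * g p.2)%:E *
      (phi i x * (z p.1 x ^+ 2 * z p.2 x ^+ 2))%:E)%E.
  rewrite expr2 big_distrlr/= pair_big/= mulr_sumr -sumEFin.
  by apply: eq_bigr => p _; rewrite -EFinM; congr EFin; ring.
under eq_integral => x _ do rewrite expand.
rewrite ge0_integral_sum//; last 2 first.
- by move=> p; exact: measurable_funeM.
- by move=> p x _; apply: mule_ge0 => //; rewrite lee_fin.
rewrite expr2 big_distrlr/= pair_big/= -sumEFin; apply: lee_sum => p _.
rewrite ge0_integralZl_EFin//.
by rewrite [in leRHS]mulrACA [leRHS]EFinM lee_wpmul2l ?lee_fin.
Qed.

End affine_moments.
End diagonal_gaussian.

(** * Differentiation of a mixture of Gaussian densities *)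

Section gaussian_taylor.
Variable R : realType.
Implicit Types z k h y : R.

Let E z := expR (- (z ^+ 2 / 2)).

Let E_gt0 z : 0 < E z. Proof. exact: expR_gt0. Qed.

Let E_le1 z : E z <= 1.
Proof. by rewrite /E -expR0 ler_expR oppr_le0 divr_ge0// sqr_ge0. Qed.

Let E_shift z k : E z * (1 - z * k - k ^+ 2 / 2) <= E (z + k).
Proof.
have -> : E (z + k) = E z * expR (- (z * k) - k ^+ 2 / 2).
  by rewrite /E -expRD; congr expR; field.
by rewrite ler_wpM2l ?(ltW (E_gt0 z))// -addrA expR_ge1Dx.
Qed.

Let sqrM_E_le z : z ^+ 2 * E z <= 2.
Proof.
have h : 1 + z ^+ 2 / 2 <= expR (z ^+ 2 / 2) by exact: expR_ge1Dx.
have e1 : E z * expR (z ^+ 2 / 2) = 1 by rewrite /E -expRD addNr expR0.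
have := ler_wpM2l (ltW (E_gt0 z)) h; rewrite e1.
by have := E_gt0 z; nra.
Qed.

Lemma normM_gauss_le z : `|z| * expR (- (z ^+ 2 / 2)) <= 3 / 2.
Proof.
have := sqrM_E_le z; have := E_le1 z; have := ltW (E_gt0 z); rewrite -/(E z).
rewrite -[in X in _ -> _ -> X -> _](real_normK (num_real z)).
have := normr_ge0 z; set a := `|z|; set e := E z => a0 e0 e1 ae.
have : 0 <= (1 - a) ^+ 2 * e by rewrite mulr_ge0// sqr_ge0.
by nra.
Qed.

(** Both bounds use only [exp x >= 1 + x], applied to the step from [z] to
    [z + k] and to the reverse step, together with the boundedness of
    [z^2 exp (- z^2 / 2)]. *)
Lemma gauss_taylor z k : `|k| <= 1 ->
  `|expR (- ((z + k) ^+ 2 / 2)) - expR (- (z ^+ 2 / 2)) +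
    k * z * expR (- (z ^+ 2 / 2))| <= 6 * k ^+ 2.
Proof.
move=> k1; rewrite -/(E z) -/(E (z + k)).
have k2 : k ^+ 2 <= 1.
  by rewrite -(real_normK (num_real k)) expr_le1.
have L := E_shift z k.
have U : E (z + k) * (1 + z * k + k ^+ 2 / 2) <= E z.
  have := E_shift (z + k) (- k); rewrite addrK.
  by have -> : 1 - (z + k) * - k - (- k) ^+ 2 / 2 = 1 + z * k + k ^+ 2 / 2
    by field.
have [ez ek] := (E_gt0 z, E_gt0 (z + k)); have [ez1 ek1] := (E_le1 z, E_le1 (z + k)).
have z2 := sqrM_E_le z; have zk2 := sqrM_E_le (z + k).
have kk := sqr_ge0 k.
rewrite ler_norml; apply/andP; split.
  have : k ^+ 2 * E z <= k ^+ 2 by rewrite ler_piMr.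
  by nra.
have [zk0|zk0] := leP 0 (z * k).
  have s1 : E (z + k) - E z + k * z * E z <= z * k * (E z - E (z + k)).
    have : 0 <= k ^+ 2 * E (z + k) by rewrite mulr_ge0// ltW.
    by nra.
  have s2 : E z - E (z + k) <= E z * (z * k + k ^+ 2 / 2) by nra.
  have s3 := le_trans s1 (ler_wpM2l zk0 s2).
  have s4 : z * k * (E z * (z * k + k ^+ 2 / 2)) =
    k ^+ 2 * (z ^+ 2 * E z) + k ^+ 2 * (z * k * E z) / 2 by field.
  have s5 : z * k * E z <= 2.
    have le1 : z * k <= (z ^+ 2 + k ^+ 2) / 2.
      by have := sqr_ge0 (z - k); rewrite sqrrB; lra.
    have := ler_wpM2r (ltW ez) le1.
    have : k ^+ 2 * E z <= 1 by have := ltW ez; nra.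
    by lra.
  have := ler_wpM2l kk z2; have := ler_wpM2l kk s5.
  by lra.
have zk0' : 0 <= - (z * k) by lra.
have s1 : E (z + k) - E z + k * z * E z <= - (z * k) * (E (z + k) - E z).
  have : 0 <= k ^+ 2 * E (z + k) by rewrite mulr_ge0// ltW.
  by nra.
have s2 : E (z + k) - E z <= E (z + k) * - (z * k).
  have : 0 <= k ^+ 2 * E (z + k) by rewrite mulr_ge0// ltW.
  by nra.
have s3 := le_trans s1 (ler_wpM2l zk0' s2).
have s4 : - (z * k) * (E (z + k) * - (z * k)) = k ^+ 2 * (z ^+ 2 * E (z + k)).
  by ring.
have s5 : z ^+ 2 * E (z + k) <= 6.
  have le1 : z ^+ 2 <= 2 * (z + k) ^+ 2 + 2 * k ^+ 2.
    by have := sqr_ge0 (z + 2 * k); nra.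
  have := ler_wpM2r (ltW ek) le1.
  have : k ^+ 2 * E (z + k) <= 1 by have := ltW ek; nra.
  by lra.
have := ler_wpM2l kk s5.
by lra.
Qed.

(** The three bounds of this section depend on the variance only through its
    lower bound [c]; this uniformity is what allows an infinite mixture to be
    differentiated term by term. *)
Section bounded_below_variance.
Variables (m v c : R).
Hypotheses (c_gt0 : 0 < c) (cv : c <= v).

Let v_gt0 : 0 < v. Proof. exact: lt_le_trans cv. Qed.
Let s := Num.sqrt v.
Let s_gt0 : 0 < s. Proof. by rewrite sqrtr_gt0. Qed.
Let s2 : s ^+ 2 = v. Proof. by rewrite sqr_sqrtr// ltW. Qed.
Let peak (u : R) := (Num.sqrt (2 * pi * u))^-1.

Let pdfE y : normal_pdf m s y = peak v * E ((y - m) / s).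
Proof.
by rewrite (normal_pdf_sqrtE m v_gt0) /E expr_div_n s2.
Qed.

Let peak_ge0 u : 0 <= peak u. Proof. by rewrite invr_ge0. Qed.

Let peak_le : peak v <= peak c.
Proof.
have pi2 : 0 < 2 * pi :> R by rewrite mulr_gt0 ?pi_gt0.
have pos (u : R) : 0 < u -> 0 < 2 * pi * u by move=> u0; exact: mulr_gt0.
have spos (u : R) : 0 < u -> Num.sqrt (2 * pi * u) \in Num.pos.
  by move=> u0; rewrite posrE sqrtr_gt0 pos.
rewrite /peak (lef_pV2 (spos _ v_gt0) (spos _ c_gt0)).
by rewrite ler_sqrt ?(ltW (pos _ v_gt0))// ler_pM2l.
Qed.

Let sV_le : s^-1 <= (Num.sqrt c)^-1.
Proof.
by rewrite lef_pV2 ?posrE ?sqrtr_gt0// ler_sqrt//; exact: ltW.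
Qed.

Lemma normal_pdf_le y : normal_pdf m (Num.sqrt v) y <= (Num.sqrt (2 * pi * c))^-1.
Proof.
rewrite pdfE -[leRHS]mulr1; apply: ler_pM => //.
exact: ltW.
Qed.

Lemma normal_pdf_score_le y :
  `|normal_pdf m (Num.sqrt v) y * ((y - m) / v)| <=
  (Num.sqrt (2 * pi * c))^-1 * (3 / 2 / Num.sqrt c).
Proof.
rewrite pdfE; set z := (y - m) / s.
have -> : peak v * E z * ((y - m) / v) = peak v * (z * E z / s).
  by rewrite /z -s2; field; rewrite gt_eqF.
rewrite normrM (ger0_norm (peak_ge0 v)); apply: ler_pM => //.
rewrite normrM (ger0_norm (_ : 0 <= s^-1)); last by rewrite invr_ge0 ltW.
apply: ler_pM => //; first by rewrite invr_ge0 ltW.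
by rewrite normrM (ger0_norm (ltW (E_gt0 z))); exact: normM_gauss_le.
Qed.

Lemma normal_pdf_taylor y h : h ^+ 2 <= c ->
  `|normal_pdf m (Num.sqrt v) (y + h) - normal_pdf m (Num.sqrt v) y +
    h * (normal_pdf m (Num.sqrt v) y * ((y - m) / v))| <=
  (Num.sqrt (2 * pi * c))^-1 * (6 / c) * h ^+ 2.
Proof.
move=> hc; rewrite !pdfE; set z := (y - m) / s; set k := h / s.
have zkE : (y + h - m) / s = z + k by rewrite /z /k -mulrDl; congr (_ / _); ring.
rewrite zkE.
have -> : peak v * E (z + k) - peak v * E z + h * (peak v * E z * ((y - m) / v)) =
    peak v * (E (z + k) - E z + k * z * E z).
  by rewrite /z /k -s2; field; rewrite gt_eqF.
rewrite normrM (ger0_norm (peak_ge0 v)) -[leRHS]mulrA; apply: ler_pM => //.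
have k2 : k ^+ 2 = h ^+ 2 / v by rewrite /k expr_div_n s2.
apply: (@le_trans _ _ (6 * k ^+ 2)).
  apply: gauss_taylor; rewrite -(@ler_pXn2r _ 2) ?nnegrE// real_normK ?num_real//.
  by rewrite expr1n k2 ler_pdivrMr// mul1r (le_trans hc).
rewrite k2 [leRHS]mulrAC -[leRHS]mulrA ler_wpM2l//.
by rewrite ler_wpM2l ?sqr_ge0// lef_pV2.
Qed.

End bounded_below_variance.
End gaussian_taylor.

Section directional_derivative.
Variable R : realType.

Lemma is_derive_quadratic (F : R -> R) (D K e : R) : 0 < e ->
  (forall h, h ^+ 2 <= e -> `|F h - F 0 - h * D| <= K * h ^+ 2) ->
  is_derive (0 : R) 1 F D.
Proof.
move=> e0 FD.
have K0 : 0 <= K.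
  have := le_trans (normr_ge0 _) (FD (Num.sqrt e) _); rewrite (sqr_sqrtr (ltW e0)).
  by move=> /(_ (lexx _)); rewrite pmulr_lge0.
suff cv : (fun h => h^-1 *: ((F \o shift 0) (h *: 1) - F 0)) @ 0^' --> D.
  by split; [apply/cvg_ex; exists D | exact: cvg_lim].
apply/cvgrPdist_le => eps eps0.
near=> h.
have hn0 : h != 0 by near: h; exact: nbhs_dnbhs_neq.
have h0 : 0 < `|h| by rewrite normr_gt0.
have he : h ^+ 2 <= e.
  have : `|h| <= Num.sqrt e.
    near: h; apply: dnbhs0_le; rewrite sqrtr_gt0//.
  by rewrite -(@ler_pXn2r _ 2) ?nnegrE// real_normK ?num_real// sqr_sqrtr// ltW.
have hK : (K + 1) * `|h| <= eps.
  rewrite -ler_pdivlMl ?ltr_wpDl// mulrC.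
  by near: h; apply: dnbhs0_le; rewrite divr_gt0// ltr_wpDl.
rewrite /= [_ + 0]addr0 [h *: 1]mulr1 -[_ *: _]/(_ * _) distrC.
have -> : h^-1 * (F h - F 0) - D = h^-1 * (F h - F 0 - h * D) by field.
rewrite normrM normfV mulrC ler_pdivrMr// (le_trans (FD _ he))//.
rewrite -(real_normK (num_real h)) expr2 mulrA ler_wpM2r//.
by rewrite (le_trans _ hK)// ler_wpM2r// lerDl.
Unshelve. all: by end_near. Qed.

(** The directional derivative along [e] is the derivative at 0 of a function of
    one real variable, to which the chain rule for [ln] applies. *)
Lemma derive_ln_quadratic n (f : 'rV[R]_n -> R) (x e : 'rV[R]_n) (D K r : R) :
  0 < r -> 0 < f x ->
  (forall h, h ^+ 2 <= r -> `|f (h *: e + x) - f x - h * D| <= K * h ^+ 2) ->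
  'D_e (fun y => ln (f y)) x = D / f x.
Proof.
move=> r0 fx0 fD.
pose F h := f (h *: e + x).
have F0 : F 0 = f x by rewrite /F scale0r add0r.
have dF : is_derive (0 : R) 1 F D.
  by apply: (is_derive_quadratic r0 (K := K)) => h hr; rewrite F0; exact: fD.
have dln : is_derive (F 0) 1 (@ln R) (F 0)^-1.
  by apply: is_derive1_ln; rewrite F0.
have [_ <-] : is_derive (0 : R) 1 (@ln R \o F) (D / f x).
  by rewrite -F0 mulrC; exact: (is_derive1_comp dln dF).
apply: (congr1 (fun g : R -> R => lim (g @ 0^'))); apply/funext => h /=.
by rewrite [_ + 0]addr0 [h *: 1]mulr1 F0.
Qed.

End directional_derivative.

Section mixture_gradient.
Variables (R : realType) (I : countType) (d : nat).
Variables (w : I -> R) (m v : I -> nat -> R) (c : nat -> R).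
Hypotheses (w_gt0 : forall i, 0 < w i) (sw : rsummable w).
Hypotheses (c_gt0 : forall j, 0 < c j) (c_le : forall i j, c j <= v i j).
Implicit Types (i : I) (x : 'rV[R]_d) (j : 'I_d).

Let v_gt0 i (k : nat) : 0 < v i k. Proof. exact: lt_le_trans (c_le i k). Qed.

Local Notation phi i := (@mix_comp R I d m v i).
Local Notation pdf i j := (normal_pdf (m i j) (Num.sqrt (v i j))).

Let B (k : nat) : R := (Num.sqrt (2 * pi * c k))^-1.
Let B_ge0 k : 0 <= B k. Proof. by rewrite invr_ge0. Qed.

Let others i j x := \prod_(k < d | k != j) pdf i k (x ord0 k).

Let others_ge0 i j x : 0 <= others i j x.
Proof. by apply: prodr_ge0 => k _; exact: normal_pdf_ge0. Qed.

Let others_le i j x : others i j x <= \prod_(k < d | k != j) B k.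
Proof.
apply: ler_prod => k _; rewrite normal_pdf_ge0/=.
exact: normal_pdf_le.
Qed.

Let phi_split i j x : phi i x = others i j x * pdf i j (x ord0 j).
Proof. by rewrite (mix_compE m v_gt0) (bigD1 j)//= mulrC. Qed.

Let phi_shift i j x h :
  phi i (h *: delta_mx ord0 j + x) = others i j x * pdf i j (x ord0 j + h).
Proof.
rewrite (phi_split _ j) !mxE !eqxx mulr1 [h + _]addrC; congr (_ * _).
by apply: eq_bigr => k kj; rewrite !mxE (negbTE kj) andbF mulr0 add0r.
Qed.

Lemma rsummable_mix x : rsummable (fun i => w i * phi i x).
Proof.
apply: rsummable_le (rsummableZ (\prod_(k < d) B k) sw) => i.
have phi0 := mix_comp_ge0 m v_gt0 i x.
rewrite ger0_norm; last by rewrite mulr_ge0// ltW.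
rewrite mulrC ler_wpM2r//; first exact: ltW.
rewrite (mix_compE m v_gt0); apply: ler_prod => k _; rewrite normal_pdf_ge0/=.
exact: normal_pdf_le.
Qed.

Let dphi i j x := phi i x * - ((x ord0 j - m i j) / v i j).

Let dphiE i j x :
  dphi i j x = - (others i j x *
    (pdf i j (x ord0 j) * ((x ord0 j - m i j) / v i j))).
Proof. by rewrite /dphi (phi_split _ j) mulrN !mulrA. Qed.

Let rsummable_dphi j x : rsummable (fun i => w i * dphi i j x).
Proof.
pose C := (\prod_(k < d | k != j) B k) * (B j * (3 / 2 / Num.sqrt (c j))).
apply: rsummable_le (rsummableZ C sw) => i.
rewrite normrM (ger0_norm (ltW (w_gt0 i))) mulrC.
rewrite ler_wpM2r//; first exact: ltW.
rewrite dphiE normrN normrM ger0_norm//; apply: ler_pM => //.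
exact: normal_pdf_score_le.
Qed.

Let phi_taylor i j x h : h ^+ 2 <= c j ->
  `|phi i (h *: delta_mx ord0 j + x) - phi i x - h * dphi i j x| <=
  (\prod_(k < d | k != j) B k) * (B j * (6 / c j)) * h ^+ 2.
Proof.
move=> hc; rewrite phi_shift dphiE (phi_split i j).
set n1 := pdf i j _; set n0 := pdf i j _; set s := (_ / v i j).
have -> : others i j x * n1 - others i j x * n0 -
    h * - (others i j x * (n0 * s)) = others i j x * (n1 - n0 + h * (n0 * s)).
  by ring.
rewrite normrM ger0_norm// -[leRHS]mulrA; apply: ler_pM => //.
by rewrite /n1 /n0 /s; exact: normal_pdf_taylor.
Qed.

Lemma mix_pdf_gt0 (i0 : I) x : 0 < mix_pdf w m v x.
Proof.
have phi0 i : 0 < w i * phi i x by rewrite mulr_gt0 ?(mix_comp_gt0 m v_gt0).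
apply: (lt_le_trans (phi0 i0)).
apply: (@ler_usum_term _ _ (fun i => w i * phi i x)) => [i|]; first exact: ltW.
exact: rsummable_mix.
Qed.

(** The score of a mixture is the posterior average of the scores of its
    components.  The Taylor remainders of the components are bounded by one
    multiple of [h^2], so their weighted sum is too. *)
Lemma gradient_ln_mix_pdf (i0 : I) x j :
  rsummable (fun i => mix_post w m v i x * mix_score m v i x ord0 j) /\
  gradient (fun y => ln (mix_pdf w m v y)) x ord0 j =
  usum (fun i => mix_post w m v i x * mix_score m v i x ord0 j).
Proof.
have rho0 := mix_pdf_gt0 i0 x.
have termE : (fun i => mix_post w m v i x * mix_score m v i x ord0 j) =
    (fun i => (mix_pdf w m v x)^-1 * (w i * dphi i j x)).
  by apply/funext => i; rewrite /mix_post (mix_score_coordE m v_gt0) /dphi; ring.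
rewrite termE; split; first exact: rsummableZ.
rewrite mxE usumZ mulrC.
pose C := (\prod_(k < d | k != j) B k) * (B j * (6 / c j)).
apply: (derive_ln_quadratic (K := C * usum w) (c_gt0 j) rho0) => h hc.
have sx := rsummable_mix x; have sh := rsummable_mix (h *: delta_mx ord0 j + x).
have sd := rsummableZ h (rsummable_dphi j x).
rewrite /mix_pdf -usumB// -(usumZ h) -usumB//; last exact: rsummableB.
have sT := rsummableB (rsummableB sh sx) sd.
rewrite (le_trans (normr_usum sT))// mulrAC -usumZ; apply: ler_usum.
- exact: rsummable_norm sT.
- exact: rsummableZ.
move=> i.
have -> : w i * phi i (h *: delta_mx ord0 j + x) - w i * phi i x -
    h * (w i * dphi i j x) =
    w i * (phi i (h *: delta_mx ord0 j + x) - phi i x - h * dphi i j x) by ring.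
rewrite normrM (ger0_norm (ltW (w_gt0 i))) mulrC ler_wpM2r//; first exact: ltW.
exact: phi_taylor.
Qed.

End mixture_gradient.

(** * Score perturbation bounds at a fixed time *)

Section bounds_ge0.
Variables (R : realType) (I : countType) (P : mixture_data R I) (d : nat) (t : R).

Lemma B_resp_ge0 : (0 <= B_resp P t d)%E.
Proof. by rewrite !mule_ge0 ?poweR_ge0// lee_fin invr_ge0 sqr_ge0. Qed.

Hypotheses (weight_gt0 : forall i, 0 < weight P i)
  (gamma_gt0 : forall j, 0 < gamma P j)
  (var_gt0 : forall i j, 0 < var P t i j).

Lemma B_comp_term_ge0 i : 0 <= weight P i * \sum_(j < d) gamma P j *
  ((dmean P i j ^+ 2 + dsigma P i j ^+ 2 / var P t i j) / pvar P t i j ^+ 2).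
Proof.
rewrite mulr_ge0 ?(ltW (weight_gt0 i))// sumr_ge0// => j _.
rewrite mulr_ge0 ?(ltW (gamma_gt0 j))// divr_ge0 ?sqr_ge0// addr_ge0 ?sqr_ge0//.
by rewrite divr_ge0 ?sqr_ge0// ltW.
Qed.

Lemma B_comp_ge0 : (0 <= B_comp P t d)%E.
Proof.
rewrite mule_ge0//; apply: esum_ge0 => i _.
by rewrite lee_fin B_comp_term_ge0.
Qed.

End bounds_ge0.

Section fixed_time.
Variables (R : realType) (I : countType) (P : mixture_data R I) (d : nat) (t : R).
Hypotheses (weight_gt0 : forall i, 0 < weight P i)
  (weight_sum1 : (\esum_(i in [set: I]) (weight P i)%:E = 1)%E)
  (pweight_gt0 : forall i, 0 < pweight P i)
  (pweight_sum1 : (\esum_(i in [set: I]) (pweight P i)%:E = 1)%E)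
  (gamma_gt0 : forall j, 0 < gamma P j)
  (beta_star_gt0 : 0 < beta_star P)
  (var_gt0 : forall i j, 0 < var P t i j)
  (pvar_gt0 : forall i j, 0 < pvar P t i j).
Implicit Types (x : 'rV[R]_d) (i l : I).

Local Notation leb := (lebesgue_rV R d).
Local Notation w := (weight P).
Local Notation b := (beta_star P).
Local Notation phi := (phi P t).
Local Notation pphi := (pphi P t).

Let q i x := w i * phi i x.
Let pq i x := pweight P i * pphi i x.
Let u i x := Defs.beta P i * Defs.ratio P t i x.
Let s i x := pscore P t i x *m sqrt_Gamma P d.
Let V i x := (score P t i x - pscore P t i x) *m sqrt_Gamma P d.

(* Measurable majorants of the two error integrands.  Their integrals, unlike
   those of the integrands, add up. *)
Let comp_maj x := (\esum_(i in [set: I]) (q i x * sqnorm (V i x))%:E)%E.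
Let D_maj x := (\esum_(i in [set: I]) (q i x * (u i x - 1) ^+ 8)%:E)%E.
Let R_maj x := (\esum_(i in [set: I]) (q i x * Defs.ratio P t i x ^- 8)%:E)%E.
Let S_maj x := (\esum_(i in [set: I]) \esum_(l in [set: I])
  (q i x * w l * sqnorm (s i x - s l x) ^+ 2)%:E)%E.
Let resp_maj x := ((b ^- 2)%:E * D_maj x `^ 4^-1 * R_maj x `^ 4^-1 *
  S_maj x `^ 2^-1)%E.

Let phi_gt0 i x : 0 < phi i x. Proof. exact: mix_comp_gt0. Qed.
Let pphi_gt0 i x : 0 < pphi i x. Proof. exact: mix_comp_gt0. Qed.
Let q_gt0 i x : 0 < q i x. Proof. by rewrite mulr_gt0. Qed.
Let q_ge0 i x : 0 <= q i x. Proof. exact: ltW. Qed.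
Let pq_gt0 i x : 0 < pq i x. Proof. by rewrite mulr_gt0. Qed.
Let pq_ge0 i x : 0 <= pq i x. Proof. exact: ltW. Qed.
Let ratio_gt0 i x : 0 < Defs.ratio P t i x. Proof. by rewrite divr_gt0. Qed.
Let u_gt0 i x : 0 < u i x. Proof. by rewrite mulr_gt0// divr_gt0. Qed.

Let quE i x : q i x * u i x = pq i x.
Proof.
by rewrite /q /u /pq /Defs.beta /Defs.ratio; field; rewrite !gt_eqF.
Qed.

Let beta_star_le i x : b * Defs.ratio P t i x <= u i x.
Proof.
rewrite ler_wpM2r ?(ltW (ratio_gt0 i x))//; apply: ge_inf; last by exists i.
by exists 0 => _ [k _ <-]; rewrite divr_ge0 ?ltW.
Qed.

Let sw : rsummable w.
Proof. by apply: ge0_rsummable => [i|]; [exact: ltW|rewrite weight_sum1 ltry]. Qed.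

Let sum_w : usum w = 1.
Proof.
by apply: EFin_inj; rewrite -ge0_usumE// => i; exact: ltW.
Qed.

Let gammaE (y : 'rV[R]_d) j :
  (y *m sqrt_Gamma P d) ord0 j = y ord0 j * Num.sqrt (gamma P j).
Proof. by rewrite /sqrt_Gamma mul_mx_diag !mxE. Qed.

Let subrVE (y z : 'rV[R]_d) j : (y - z) ord0 j = y ord0 j - z ord0 j.
Proof. by rewrite !mxE. Qed.

Let scoreE i x j :
  score P t i x ord0 j = - ((x ord0 j - mean P i j) / var P t i j).
Proof. exact: mix_score_coordE. Qed.

Let pscoreE i x j :
  pscore P t i x ord0 j = - ((x ord0 j - pmean P i j) / pvar P t i j).
Proof. exact: mix_score_coordE. Qed.

Let V_sqnormE i x : sqnorm (V i x) = \sum_(j < d) gamma P j *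
  (((pvar P t i j)^-1 - (var P t i j)^-1) * (x ord0 j - mean P i j) +
   - (dmean P i j / pvar P t i j)) ^+ 2.
Proof.
apply: eq_bigr => j _; rewrite gammaE subrVE scoreE pscoreE.
rewrite exprMn sqr_sqrtr ?(ltW (gamma_gt0 j))// mulrC.
by congr (_ * _ ^+ 2); rewrite /pmean; field; rewrite !gt_eqF.
Qed.

Let s_sqnormE i l x : sqnorm (s i x - s l x) = \sum_(j < d) gamma P j *
  (- a_pair P t i l j * (x ord0 j - mean P i j) + mu_pair P t i l j) ^+ 2.
Proof.
apply: eq_bigr => j _; rewrite subrVE !gammaE !pscoreE -mulrBl.
rewrite exprMn sqr_sqrtr ?(ltW (gamma_gt0 j))// mulrC.
congr (_ * _ ^+ 2); rewrite /pmean /a_pair /mu_pair; field.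
by rewrite !gt_eqF.
Qed.

Let rho_ge0 x : 0 <= rho P t x.
Proof. by apply: usum_ge0 => i; exact: q_ge0. Qed.

(* A divergent density is given the value 0 by [usum]. *)
Let rho0 x : ~ rsummable (q ^~ x) -> rho P t x = 0.
Proof.
have [oo _|[sq _ /(_ sq)//]] := esum_EFin_cases (q_ge0 ^~ x).
by rewrite (ge0_usum (q_ge0 ^~ x) : rho P t x = _) oo.
Qed.

Lemma comp_pointwise x :
  ((rho P t x)%:E * sqnorm_usum (fun i =>
    post P t i x *: ((score P t i x - pscore P t i x) *m sqrt_Gamma P d)) <=
   comp_maj x)%E.
Proof.
have c0 : (0 <= comp_maj x)%E.
  by apply: esum_ge0 => i _; rewrite lee_fin mulr_ge0// sqnorm_ge0.
have [sq|nsq] := pselect (rsummable (q ^~ x)); last by rewrite (rho0 nsq) mul0e.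
have := rho_ge0 x; rewrite le_eqVlt => /predU1P[<-|rho_gt0]; first by rewrite mul0e.
exact: (jensen_sqnorm_usum _ (q_ge0 ^~ x)).
Qed.

Lemma resp_pointwise x : rsummable (pq ^~ x) ->
  ((rho P t x)%:E * sqnorm_usum (fun i =>
    (post P t i x - ppost P t i x) *: (pscore P t i x *m sqrt_Gamma P d)) <=
   resp_maj x)%E.
Proof.
move=> spq.
have r0 : (0 <= resp_maj x)%E.
  by rewrite !mule_ge0 ?poweR_ge0// lee_fin invr_ge0 sqr_ge0.
have [sq|nsq] := pselect (rsummable (q ^~ x)); last by rewrite (rho0 nsq) mul0e.
have quf : (fun i => q i x * u i x) = pq ^~ x by apply/funext => i; exact: quE.
have squ : rsummable (fun i => q i x * u i x) by rewrite quf.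
have := @posterior_error_bound _ _ d (q ^~ x) (u ^~ x)
  (fun i => Defs.ratio P t i x) w
  (s ^~ x) b (q_gt0 ^~ x) (u_gt0 ^~ x) (ratio_gt0 ^~ x) weight_gt0
  beta_star_gt0 (beta_star_le ^~ x) sq squ sw sum_w.
rewrite quf; under [X in (_ * sqnorm_usum X <= _)%E -> _]eq_fun do rewrite quE.
exact.
Qed.

Let measurable_phi i : measurable_fun setT (phi i : 'rV[R]_d -> R).
Proof. exact: measurable_mix_comp. Qed.

Let measurable_pphi i : measurable_fun setT (pphi i : 'rV[R]_d -> R).
Proof. exact: measurable_mix_comp. Qed.

Let measurable_inv_pos (f : 'rV[R]_d -> R) : (forall x, 0 < f x) ->
  measurable_fun setT f -> measurable_fun setT (fun x => (f x)^-1).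
Proof.
move=> f0 mf; rewrite (_ : (fun x => _) = (fun x => f x `^ (-1))).
  exact: (measurableT_comp (measurable_powR _) mf).
by apply/funext => x; rewrite powR_inv1// ltW.
Qed.

Let measurable_ratio i : measurable_fun setT (Defs.ratio P t i : 'rV[R]_d -> R).
Proof. by apply: measurable_funM => //; exact: measurable_inv_pos. Qed.

Let measurable_q i : measurable_fun setT (q i).
Proof. exact: measurable_funM. Qed.

Let measurable_quadratic i (a c g : 'I_d -> R) : measurable_fun setT
  (fun x => \sum_(j < d) g j * (a j * (x ord0 j - mean P i j) + c j) ^+ 2).
Proof.
apply: measurable_sum => j; apply: measurable_funM => //.
apply: measurable_funX; apply: measurable_funD => //.
apply: measurable_funM => //; apply: measurable_funB => //.
exact: measurable_coord.
Qed.

Let measurable_V i : measurable_fun setT (fun x => sqnorm (V i x)).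
Proof.
under eq_fun do rewrite V_sqnormE.
exact: (measurable_quadratic i _ (fun j => - (dmean P i j / pvar P t i j))).
Qed.

Let measurable_s i l : measurable_fun setT (fun x => sqnorm (s i x - s l x)).
Proof.
under eq_fun do rewrite s_sqnormE.
exact: (measurable_quadratic i _ (fun j => mu_pair P t i l j)).
Qed.

Let comp_term_ge0 i x : (0 <= (q i x * sqnorm (V i x))%:E)%E.
Proof. by rewrite lee_fin mulr_ge0// sqnorm_ge0. Qed.

Let D_term_ge0 i x : (0 <= (q i x * (u i x - 1) ^+ 8)%:E)%E.
Proof. by rewrite lee_fin mulr_ge0// (exprM _ 4 2) sqr_ge0. Qed.

Let R_term_ge0 i x : (0 <= (q i x * Defs.ratio P t i x ^- 8)%:E)%E.
Proof. by rewrite lee_fin mulr_ge0// invr_ge0 exprn_ge0// ltW. Qed.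

Let S_term_ge0 i l x : (0 <= (q i x * w l * sqnorm (s i x - s l x) ^+ 2)%:E)%E.
Proof. by rewrite lee_fin mulr_ge0 ?sqr_ge0// mulr_ge0// ltW. Qed.

Let measurable_comp_term i :
  measurable_fun setT (fun x => (q i x * sqnorm (V i x))%:E).
Proof. by apply/measurable_EFinP; exact: measurable_funM. Qed.

Let measurable_D_term i :
  measurable_fun setT (fun x => (q i x * (u i x - 1) ^+ 8)%:E).
Proof.
apply/measurable_EFinP; apply: measurable_funM => //.
by apply: measurable_funX; apply: measurable_funB => //; exact: measurable_funM.
Qed.

Let measurable_R_term i :
  measurable_fun setT (fun x => (q i x * Defs.ratio P t i x ^- 8)%:E).
Proof.
apply/measurable_EFinP; apply: measurable_funM => //.
under eq_fun do rewrite -exprVn.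
by apply: measurable_funX; exact: measurable_inv_pos.
Qed.

Let measurable_S_term i l :
  measurable_fun setT (fun x => (q i x * w l * sqnorm (s i x - s l x) ^+ 2)%:E).
Proof.
apply/measurable_EFinP; apply: measurable_funM; first exact: measurable_funM.
exact: measurable_funX.
Qed.

Let measurable_comp_maj : measurable_fun setT comp_maj.
Proof. exact: emeasurable_fun_esum. Qed.

Let measurable_D_maj : measurable_fun setT D_maj.
Proof. exact: emeasurable_fun_esum. Qed.

Let measurable_R_maj : measurable_fun setT R_maj.
Proof. exact: emeasurable_fun_esum. Qed.

Let measurable_S_maj : measurable_fun setT S_maj.
Proof.
apply: emeasurable_fun_esum => [i x|i]; first exact: esum_ge0.
exact: emeasurable_fun_esum.
Qed.

Let measurable_resp_maj : measurable_fun setT resp_maj.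
Proof.
apply: emeasurable_funM; last exact: emeasurable_fun_poweR.
apply: emeasurable_funM; last exact: emeasurable_fun_poweR.
by apply: measurable_funeM; exact: emeasurable_fun_poweR.
Qed.

Let D_maj_ge0 x : (0 <= D_maj x)%E. Proof. exact: esum_ge0. Qed.
Let R_maj_ge0 x : (0 <= R_maj x)%E. Proof. exact: esum_ge0. Qed.
Let comp_maj_ge0 x : (0 <= comp_maj x)%E. Proof. exact: esum_ge0. Qed.
Let S_maj_ge0 x : (0 <= S_maj x)%E.
Proof. by apply: esum_ge0 => i _; exact: esum_ge0. Qed.
Let resp_maj_ge0 x : (0 <= resp_maj x)%E.
Proof. by rewrite !mule_ge0 ?poweR_ge0// lee_fin invr_ge0 sqr_ge0. Qed.

Let integral_weighted i (k : R) (g : 'rV[R]_d -> R) : 0 <= k ->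
  (forall x, 0 <= g x) -> measurable_fun setT g ->
  (\int[leb]_x (k * (phi i x * g x))%:E = k%:E * \int[leb]_x (phi i x * g x)%:E)%E.
Proof.
move=> k0 g0 mg; under eq_integral do rewrite EFinM.
rewrite ge0_integralZl_EFin//.
- by move=> x _; rewrite lee_fin mulr_ge0// ltW.
- by apply/measurable_EFinP; exact: measurable_funM.
Qed.

Lemma integral_comp_maj : (\int[leb]_x comp_maj x <= B_comp P t d)%E.
Proof.
rewrite /comp_maj integral_esum// /B_comp -esumZl//; last first.
  by move=> i; rewrite lee_fin B_comp_term_ge0.
apply: le_esum => i _.
under eq_integral do rewrite -mulrA.
rewrite integral_weighted; last 3 first.
- exact: ltW.
- by move=> x; exact: sqnorm_ge0.
- by [].
rewrite -EFinM mulrCA EFinM lee_wpmul2l//; first by rewrite lee_fin ltW.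
under eq_integral do rewrite V_sqnormE.
apply: le_trans (@integral_mix_comp_sqnorm_le _ _ d (mean P) (var P t) var_gt0 i
  (fun j => (pvar P t i j)^-1 - (var P t i j)^-1)
  (fun j => - (dmean P i j / pvar P t i j)) (fun j => gamma P j) _) _.
  by move=> j; exact: ltW.
rewrite lee_fin le_eqVlt; apply/orP; left; apply/eqP; congr (_ * _).
apply: eq_bigr => j _; congr (_ * _).
have vpE : dsigma P i j = pvar P t i j - var P t i j.
  by rewrite /pvar /var; ring.
by rewrite vpE; field; rewrite !gt_eqF.
Qed.

Lemma integral_D_maj : (\int[leb]_x D_maj x = D_resp P t d)%E.
Proof.
rewrite /D_maj integral_esum//; apply: eq_esum => i _.
under eq_integral do rewrite -mulrA.
rewrite integral_weighted; last 3 first.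
- exact: ltW.
- by move=> x; rewrite (exprM _ 4 2) sqr_ge0.
- by apply: measurable_funX; apply: measurable_funB => //; exact: measurable_funM.
by congr (_ * _)%E.
Qed.

Lemma integral_R_maj : (\int[leb]_x R_maj x = R_resp P t d)%E.
Proof.
rewrite /R_maj integral_esum//; apply: eq_esum => i _.
under eq_integral do rewrite -mulrA.
rewrite integral_weighted; last 3 first.
- exact: ltW.
- by move=> x; rewrite invr_ge0 exprn_ge0// ltW.
- under eq_fun do rewrite -exprVn.
  by apply: measurable_funX; exact: measurable_inv_pos.
by congr (_ * _)%E.
Qed.

Lemma integral_S_maj : (\int[leb]_x S_maj x <= S_pair P t d)%E.
Proof.
rewrite /S_maj integral_esum; last 2 first.
- by move=> i x; exact: esum_ge0.
- by move=> i; exact: emeasurable_fun_esum.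
apply: le_esum => i _; rewrite integral_esum//; apply: le_esum => l _.
have E x : q i x * w l * sqnorm (s i x - s l x) ^+ 2 =
    w i * w l * (phi i x * sqnorm (s i x - s l x) ^+ 2) by rewrite /q; ring.
under eq_integral do rewrite E.
have ww : 0 <= w i * w l by rewrite mulr_ge0// ltW.
rewrite integral_weighted//; last 2 first.
- by move=> x; exact: sqr_ge0.
- exact: measurable_funX.
rewrite [leRHS]EFinM lee_wpmul2l//.
under eq_integral do rewrite s_sqnormE.
apply: le_trans (@integral_mix_comp_sqnorm2_le _ _ d (mean P) (var P t) var_gt0 i
  (fun j => - a_pair P t i l j) (fun j => mu_pair P t i l j)
  (fun j => gamma P j) _) _.
  by move=> j; exact: ltW.
rewrite lee_fin le_eqVlt; apply/orP; left; apply/eqP; congr (_ ^+ 2).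
apply: eq_bigr => j _; congr (_ * Num.sqrt _).
by rewrite sqrrN (exprM _ 2 2) sqrrN -exprM.
Qed.

(** Hölder with exponents 4, 4 and 2 distributes the integral over the three
    factors of the majorant. *)
Lemma integral_resp_maj : (\int[leb]_x resp_maj x <= B_resp P t d)%E.
Proof.
have b2 : (0 <= (b ^- 2)%:E)%E by rewrite lee_fin invr_ge0 sqr_ge0.
have assoc (k x y z : \bar R) : (k * x * y * z = k * (x * y * z))%E.
  by rewrite !muleA.
rewrite /B_resp assoc (eq_integral (fun x => (b ^- 2)%:E *
  (D_maj x `^ 4^-1 * R_maj x `^ 4^-1 * S_maj x `^ 2^-1))%E); last first.
  by move=> x _; exact: assoc.
rewrite ge0_integralZl//; last 2 first.
- apply: emeasurable_funM; last exact: emeasurable_fun_poweR.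
  by apply: emeasurable_funM; exact: emeasurable_fun_poweR.
- by move=> x _; rewrite !mule_ge0 ?poweR_ge0.
apply: lee_wpmul2l => //.
apply: le_trans (integral_hoelder_442 _ measurable_D_maj measurable_R_maj
  measurable_S_maj D_maj_ge0 R_maj_ge0 S_maj_ge0) _.
rewrite integral_D_maj integral_R_maj lee_wpmul2l ?mule_ge0 ?poweR_ge0//.
have S0 : (0 <= \int[leb]_x S_maj x)%E by exact: integral_ge0.
have leS := integral_S_maj.
apply: gt0_ler_poweR; rewrite ?invr_ge0 ?in_itv//= ?leey ?andbT//.
exact: le_trans leS.
Qed.

Lemma comp_error_le : (comp_error P t d <= B_comp P t d)%E.
Proof.
apply: le_trans integral_comp_maj; apply: ge0_le_integral_nonmeas => x.
  by rewrite mule_ge0 ?lee_fin ?rho_ge0// sqnorm_usum_ge0.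
exact: comp_pointwise.
Qed.

(** The pointwise bound needs the perturbed density to be finite at the point,
    which holds almost everywhere since that density has integral 1. *)
Lemma resp_error_le : (resp_error P t d <= B_resp P t d)%E.
Proof.
pose prho_maj x := (\esum_(i in [set: I]) (pq i x)%:E)%E.
have mpq i : measurable_fun setT (fun x => (pq i x)%:E).
  by apply/measurable_EFinP; exact: measurable_funM.
have m1 : measurable_fun setT prho_maj.
  by apply: emeasurable_fun_esum => // i x; rewrite lee_fin.
have p0 x : (0 <= prho_maj x)%E by apply: esum_ge0 => i _; rewrite lee_fin.
have int1 : (\int[leb]_x prho_maj x = 1)%E.
  rewrite /prho_maj integral_esum; [|by move=> i x; rewrite lee_fin|by []].
  rewrite -[RHS]pweight_sum1; apply: eq_esum => i _.
  under eq_integral do rewrite EFinM.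
  rewrite ge0_integralZl_EFin//.
  - by rewrite (integral_mix_comp d (pmean P) pvar_gt0) mule1.
  - by move=> x _; rewrite lee_fin; exact/ltW/pphi_gt0.
  - exact/measurable_EFinP.
  - exact: ltW.
have [N [mN N0 subN]] : {ae leb, forall x, setT x -> prho_maj x \is a fin_num}.
  apply: integrable_ae => //; apply/integrableP; split=> //.
  under eq_integral do rewrite gee0_abs//.
  by rewrite int1 ltry.
apply: le_trans integral_resp_maj.
rewrite -[leLHS]mul1e; apply: (ge0_le_integral_off mN N0) => //.
- by move=> x _; rewrite mule_ge0 ?lee_fin ?rho_ge0// sqnorm_usum_ge0.
- move=> x _ Nx; rewrite mul1e; apply: resp_pointwise.
  apply: ge0_rsummable => //; rewrite -ge0_fin_numE//; last exact: p0.
  by apply: contrapT => nf; apply: Nx; apply: subN => /= /(_ Logic.I).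
Qed.

(** When the variances are bounded below along each coordinate, uniformly in the
    component, both densities are finite and differentiable everywhere. *)
Section score_error_bound.
Variable c : nat -> R.
Hypotheses (c_gt0 : forall j, 0 < c j) (c_var : forall i j, c j <= var P t i j).
Hypothesis c_pvar : forall i j, c j <= pvar P t i j.

Let spw : rsummable (pweight P).
Proof. by apply: ge0_rsummable => [i|]; [exact: ltW|rewrite pweight_sum1 ltry]. Qed.

(** If the series of the component error converges at [x], so does the series
    of the responsibility error, and the score error is the sum of the two.
    Otherwise [comp_maj x] is infinite. *)
Let score_error_pointwise x :
  ((rho P t x)%:E * (sqnorm (score_error P t x *m sqrt_Gamma P d))%:E <=
   2%:E * (comp_maj x + resp_maj x))%E.
Proof.
have [i0] : inhabited I.
  by apply: (@usum_neq0_inhabited R I w); rewrite sum_w oner_neq0.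
have rho_gt0 : 0 < rho P t x.
  exact: (mix_pdf_gt0 (mean P) weight_gt0 sw c_gt0 c_var i0 x).
have gpost := gradient_ln_mix_pdf (mean P) weight_gt0 sw c_gt0 c_var i0 x.
have gppost := gradient_ln_mix_pdf (pmean P) pweight_gt0 spw c_gt0 c_pvar i0 x.
pose Fc i := post P t i x *: V i x.
pose Fr i := (post P t i x - ppost P t i x) *: s i x.
have comp_le : ((rho P t x)%:E * sqnorm_usum Fc <= comp_maj x)%E.
  exact: comp_pointwise.
have resp_le : ((rho P t x)%:E * sqnorm_usum Fr <= resp_maj x)%E.
  apply: resp_pointwise.
  exact: (rsummable_mix (pmean P) pweight_gt0 spw c_gt0 c_pvar x).
have scaleE (k : R) (y : 'rV[R]_d) j : (k *: y) ord0 j = k * y ord0 j.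
  by rewrite mxE.
have [sc|nsc] := pselect (forall j, rsummable (fun i => Fc i ord0 j)); last first.
  have coo : comp_maj x = +oo%E.
    apply/eqP; rewrite -leye_eq; apply: le_trans comp_le.
    by rewrite /sqnorm_usum asboolF// gt0_muley.
  by rewrite coo addye ?gt0_muley ?leey// gt_eqF// (lt_le_trans (ltNyr 0)).
have FrE j : (fun i => Fr i ord0 j) = (fun i => Num.sqrt (gamma P j) *
    (post P t i x * score P t i x ord0 j - ppost P t i x * pscore P t i x ord0 j) -
    Fc i ord0 j).
  by apply/funext => i; rewrite !scaleE !gammaE subrVE; ring.
have sd j : rsummable (fun i => post P t i x * score P t i x ord0 j -
    ppost P t i x * pscore P t i x ord0 j).
  exact: rsummableB (gpost j).1 (gppost j).1.
have sr j : rsummable (fun i => Fr i ord0 j).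
  by rewrite FrE; apply: rsummableB => //; exact: rsummableZ.
have errE j : (score_error P t x *m sqrt_Gamma P d) ord0 j =
    usum (fun i => Fc i ord0 j) + usum (fun i => Fr i ord0 j).
  rewrite gammaE FrE (usumB (rsummableZ _ (sd j)) (sc j)) addrC subrK usumZ mulrC.
  congr (_ * _); rewrite (usumB (gpost j).1 (gppost j).1) -(gpost j).2 -(gppost j).2.
  exact: subrVE.
rewrite (sqnorm_usumE sc) in comp_le; rewrite (sqnorm_usumE sr) in resp_le.
apply: le_trans (lee_wpmul2l _ (leeD comp_le resp_le)); last by rewrite lee_fin.
rewrite -!EFinM lee_fin -mulrDr mulrCA ler_wpM2l ?(ltW rho_gt0)//.
rewrite -big_split/= mulr_sumr; apply: ler_sum => j _; rewrite errE.
set A := usum _; set B := usum _.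
rewrite -subr_ge0.
have -> : 2 * (A ^+ 2 + B ^+ 2) - (A + B) ^+ 2 = (A - B) ^+ 2 by ring.
exact: sqr_ge0.
Qed.

Lemma expect_score_error_le :
  (expect (@rho R I P t d) (fun x =>
     (sqnorm (score_error P t x *m sqrt_Gamma P d))%:E) <=
   2%:E * (B_comp P t d + B_resp P t d))%E.
Proof.
apply: (@le_trans _ _ (\int[leb]_x (2%:E * (comp_maj x + resp_maj x)))%E).
  apply: ge0_le_integral_nonmeas => x; last exact: score_error_pointwise.
  by rewrite mule_ge0// lee_fin ?rho_ge0 ?sqnorm_ge0.
rewrite ge0_integralZl_EFin//; last 2 first.
- by move=> x _; rewrite adde_ge0.
- exact: emeasurable_funD.
rewrite lee_wpmul2l// ge0_integralD// leeD//.
- exact: integral_comp_maj.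
- exact: integral_resp_maj.
Qed.

End score_error_bound.
End fixed_time.

Theorem proposition4p4 (R : realType) (I : countType) (P : mixture_data R I)
  (horizon_gt0 : 0 < horizon P)
  (weight_gt0 : forall i, 0 < weight P i)
  (weight_sum1 : (\esum_(i in [set: I]) (weight P i)%:E = 1)%E)
  (mean_summable : forall i, (\sum_(0 <= j <oo) (mean P i j ^+ 2)%:E < +oo)%E)
  (sigma_gt0 : forall i j, 0 < sigma P i j)
  (sigma_summable : forall i, (\sum_(0 <= j <oo) (sigma P i j)%:E < +oo)%E)
  (lambda_gt0 : forall j, 0 < lambda P j)
  (lambda_summable : (\sum_(0 <= j <oo) (lambda P j)%:E < +oo)%E)
  (gamma_gt0 : forall j, 0 < gamma P j)
  (psigma_gt0 : forall i j, 0 < sigma P i j + dsigma P i j)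
  (pweight_gt0 : forall i, 0 < pweight P i)
  (pweight_sum1 : (\esum_(i in [set: I]) (pweight P i)%:E = 1)%E)
  (d : nat) (d_gt0 : (0 < d)%N)
  (beta_star_gt0 : 0 < beta_star P) :
  [/\ forall t, t \in `[0, horizon P] ->
        (infinite_set [set: I] -> (B_comp P t d < +oo)%E) ->
        (comp_error P t d <= B_comp P t d)%E,
      forall t, t \in `[0, horizon P] ->
        (infinite_set [set: I] ->
          [/\ D_resp P t d < +oo, R_resp P t d < +oo & S_pair P t d < +oo]%E) ->
        (resp_error P t d <= B_resp P t d)%E
    & (infinite_set [set: I] ->
        {ae lebesgue_measure, forall t : R, t \in `[0, horizon P] ->
          [/\ B_comp P t d < +oo, D_resp P t d < +oo, R_resp P t d < +oo &
              S_pair P t d < +oo]%E}) ->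
      (E_score P d <=
        \int[lebesgue_measure]_(t in `[0%R, horizon P])
          (B_comp P t d + B_resp P t d))%E].
Proof.
have kappa_ge0 t : t \in `[0, horizon P] -> 0 <= kappa P t.
  by rewrite in_itv/= => /andP[_ tT]; rewrite divr_ge0 ?subr_ge0//; exact: ltW.
have var_gt0 t : t \in `[0, horizon P] -> forall i j, 0 < var P t i j.
  move=> tT i j; rewrite ltr_wpDr//; rewrite mulr_ge0 ?kappa_ge0//; exact: ltW.
have pvar_gt0 t : t \in `[0, horizon P] -> forall i j, 0 < pvar P t i j.
  move=> tT i j; rewrite ltr_wpDr//; rewrite mulr_ge0 ?kappa_ge0//; exact: ltW.
split=> [t tT _|t tT _|_].
- by apply: comp_error_le => //; [exact: var_gt0|exact: pvar_gt0].
- by apply: resp_error_le => //; [exact: var_gt0|exact: pvar_gt0].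
have B_ge0 t : t \in `[0, horizon P] -> (0 <= B_comp P t d + B_resp P t d)%E.
  move=> tT; rewrite adde_ge0 ?B_resp_ge0//; apply: B_comp_ge0 => //.
  exact: var_gt0.
have rho_ge0 t x : t \in `[0, horizon P] -> 0 <= @rho R I P t d x.
  move=> tT; apply: usum_ge0 => i.
  by rewrite mulr_ge0 ?(ltW (weight_gt0 i))// mix_comp_ge0//; exact: var_gt0.
rewrite /E_score.
(* At the horizon the factor kappa vanishes, and with it the lower bound on the
   variances; this time is left out as a null set. *)
have mN : measurable ([set horizon P] : set (measurableTypeR R)).
  exact: measurable_set1.
apply: (ge0_le_integral_off mN (lebesgue_measure_set1 _)) => //.
- move=> t tT; apply: integral_ge0 => x _.
  by rewrite mule_ge0// lee_fin ?rho_ge0// sqnorm_ge0.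
- move=> t tT tnT.
  have kappa_gt0 : 0 < kappa P t.
    rewrite divr_gt0// subr_gt0 lt_neqAle.
    by move: tT; rewrite /= in_itv/= => /andP[_ ->]; rewrite andbT; apply/eqP.
  have c_gt0 j : 0 < kappa P t * lambda P j by rewrite mulr_gt0.
  have c_var i j : kappa P t * lambda P j <= var P t i j.
    by rewrite lerDr ltW.
  have c_pvar i j : kappa P t * lambda P j <= pvar P t i j.
    by rewrite lerDr ltW.
  rewrite lee_pdivrMl//.
  exact: (expect_score_error_le d weight_gt0 weight_sum1 pweight_gt0
    pweight_sum1 gamma_gt0 beta_star_gt0 (var_gt0 _ tT) (pvar_gt0 _ tT) c_gt0
    c_var c_pvar).
Qed.
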